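(* For every prime $p$, the number $mq(p^2)$ of isomorphism classes of medial quasigroups of order $p^2$ satisfies $$mq(p^2)=mq(\mathbb{Z}_{p^2})+mq(\mathbb{Z}_p^2)=2p^4-p^3-p^2-3p-1,$$ where, for a finite abelian group $G$, $mq(G)$ denotes the number of medial quasigroups that admit an affine form over $G$, counted up to isomorphism.
   Context: A quasigroup is a set $Q$ with a binary operation $*$ such that for all $a,b\in Q$ the equations $a*x=b$ and $y*a=b$ have unique solutions $x,y\in Q$. A quasigroup $(Q,* )$ is medial if $(x*y)*(u*v)=(x*u)*(y*v)$ for all $x,y,u,v\in Q$. Given an abelian group $G=(G,+)$, automorphisms $\varphi,\psi$ of $G$, and an element $c\in G$, let $\mathcal{Q}(G,+,\varphi,\psi,c)$ denote the quasigroup $(G,* )$ with $x*y=\varphi(x)+\psi(y)+c$. A quasigroup admits an affine form over $G$ if it is isomorphic to $\mathcal{Q}(G,+,\varphi,\psi,c)$ for some automorphisms $\varphi,\psi$ of $G$ and some $c\in G$. For a positive integer $n$, $mq(n)$ denotes the number of medial quasigroups of order $n$ (i.e. with $n$ elements), counted up to isomorphism of quasigroups. $\mathbb{Z}_n$ denotes the cyclic group of order $n$, and $\mathbb{Z}_p^2=\mathbb{Z}_p\times\mathbb{Z}_p$. *)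

(* Defs.v *)
From HB Require Import structures.
From mathcomp Require Import all_boot all_order all_fingroup all_algebra.
Set Implicit Arguments.
Unset Strict Implicit.
Unset Printing Implicit Defensive.
Import GRing.Theory.
Local Open Scope ring_scope.

(* The library equips a product of finZmodTypes with its componentwise zmodType
   structure and its finType structure, but does not join the two. *)
HB.instance Definition _ (U V : finZmodType) := GRing.Zmodule.on (U * V)%type.

Definition binop (T : finType) := {ffun T * T -> T}.

Definition quasigroup (T : finType) (op : binop T) : bool :=
  [forall a, forall b, (#|[set x | op (a, x) == b]| == 1%N) &&
                       (#|[set y | op (y, a) == b]| == 1%N)].

Definition medial (T : finType) (op : binop T) : bool :=
  [forall x, forall y, forall u, forall v,
     op (op (x, y), op (u, v)) == op (op (x, u), op (y, v))].

Definition isomorphic (T1 T2 : finType) (op1 : binop T1) (op2 : binop T2) :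
    bool :=
  [exists f : {ffun T1 -> T2},
    [&& injectiveb f, [forall z, exists x, f x == z] &
        [forall x, forall y, f (op1 (x, y)) == op2 (f x, f y)]]].

Definition affine_op (G : finZmodType) (phi psi : {perm G}) (c : G) : binop G :=
  [ffun xy => phi xy.1 + psi xy.2 + c].

(* For a finZmodType G, the canonical finGroupType structure on G has addition
   as its group law, so Aut [set: G] is the set of additive automorphisms. *)
Definition affine_form (G : finZmodType) (T : finType) (op : binop T) : bool :=
  [exists phi in Aut [set: G], exists psi in Aut [set: G], exists c : G,
     isomorphic op (affine_op phi psi c)].

(* D is to be read up to isomorphism: isomorphic is an equivalence relation on
   binop T, and the blocks of the partition are the classes met by D. *)
Definition num_iso_classes (T : finType) (D : {set binop T}) : nat :=
  #|equivalence_partition (@isomorphic T T) D|.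

(* Every quasigroup of order n is isomorphic to one with carrier 'I_n. *)
Definition mq (n : nat) : nat :=
  num_iso_classes [set op : binop 'I_n | quasigroup op && medial op].

(* A quasigroup with an affine form over G has order #|G|. *)
Definition mq_over (G : finZmodType) : nat :=
  num_iso_classes [set op : binop 'I_#|G|
                     | [&& quasigroup op, medial op & affine_form G op]].

(* Main.v *)
(** By Toyoda's theorem a medial quasigroup is affine over an abelian group, of
    the form phi x + psi y + c with commuting automorphisms phi and psi, and an
    isomorphism of affine quasigroups is an affine map.  So the classes over G
    are the orbits of Aut G on the triples (phi, psi, c), where c matters only
    modulo the image of 1 - phi - psi, and the two groups of order p^2 never
    share a class.  Over Z_(p^2) the automorphisms are units and the orbits are
    read off from the ideal generated by 1 - phi - psi.  Over the plane, normal
    forms of the triples are found in a basis adapted to them: a cyclic vector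
    when c can be translated to 0, and otherwise c itself completed by a second
    vector. *)

Require Import Defs.
From HB Require Import structures.
From mathcomp Require Import all_boot all_order all_fingroup all_algebra.
From mathcomp Require Import cyclic ring.
Set Implicit Arguments.
Unset Strict Implicit.
Unset Printing Implicit Defensive.
Import GRing.Theory.
Local Open Scope ring_scope.

(** * Isomorphism classes of binary operations *)

(** Every count comes from an explicit system of representatives: each triple reaches one of them,
    and invariants keep them apart, so no orbit-counting formula is involved. The invariants are
    traces, determinants and, when the constant survives, the eigenvalue on a distinguished line.

    Over the plane the matrix [gam A B], that is 1 - A - B, decides everything. If its image
    contains c, commuting pairs remain to be counted up to simultaneous conjugacy, and a non-scalar
    2 by 2 matrix commutes only with polynomials in itself. Otherwise gam is singular and has one of
    three shapes. If it is zero, translations do nothing and c moves only under the linear part. If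
    its trace is nonzero, its kernel and image are two lines preserved by A and B. If it is nonzero
    of trace zero, it is nilpotent, and c, gam c form a basis.

    Cardinalities are natural numbers with truncated predecessors, so one count is stated with its
    subtrahend on the other side, and integers enter only at the very end. *)

Lemma isomorphicP (T1 T2 : finType) (op1 : binop T1) (op2 : binop T2) :
  reflect (exists2 f : T1 -> T2, bijective f &
             forall x y, f (op1 (x, y)) = op2 (f x, f y))
          (isomorphic op1 op2).
Proof.
apply: (iffP existsP) => [[f /and3P[/injectiveP fI /forallP fS /forallP fM]]|].
  exists f => [|x y]; last by move/forallP/(_ y)/eqP: (fM x).
  apply: inj_card_bij => //.
  rewrite -(card_codom fI); apply/subset_leq_card/subsetP => z _.
  by have /existsP[x /eqP<-] := fS z; apply: codom_f.
case=> f [g fK gK] fM; exists (finfun f); apply/and3P; split.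
- by apply/injectiveP => x y; rewrite !ffunE => /(can_inj fK).
- by apply/forallP => z; apply/existsP; exists (g z); rewrite ffunE gK.
- by apply/forallP => x; apply/forallP => y; rewrite !ffunE fM.
Qed.

Lemma isomorphic_refl (T : finType) (op : binop T) : isomorphic op op.
Proof. by apply/isomorphicP; exists id => //; exists id. Qed.

Lemma isomorphic_sym (T1 T2 : finType) (op1 : binop T1) (op2 : binop T2) :
  isomorphic op1 op2 -> isomorphic op2 op1.
Proof.
case/isomorphicP=> f [g fK gK] fM; apply/isomorphicP.
by exists g => [|x y]; [exists f | apply: (can_inj fK); rewrite gK fM !gK].
Qed.

Lemma isomorphic_trans (T1 T2 T3 : finType) (op1 : binop T1) (op2 : binop T2)
    (op3 : binop T3) :
  isomorphic op1 op2 -> isomorphic op2 op3 -> isomorphic op1 op3.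
Proof.
case/isomorphicP=> f bf fM /isomorphicP[g bg gM]; apply/isomorphicP.
by exists (g \o f) => [|x y /=]; [apply: bij_comp | rewrite fM gM].
Qed.

Lemma quasigroupP (T : finType) (op : binop T) :
  reflect ((forall a, injective (fun x => op (a, x))) /\
           (forall a, injective (fun y => op (y, a))))
          (quasigroup op).
Proof.
have solve (f : T -> T) : injective f -> forall b, #|[set x | f x == b]| == 1%N.
  move=> fI b; apply/cards1P; exists (invF fI b); apply/setP => x.
  by rewrite !inE (can2_eq (invF_f fI) (f_invF fI)).
have inj (f : T -> T) : (forall b, #|[set x | f x == b]| == 1%N) -> injective f.
  move=> f1 x y e; have /cards1P[z /setP Ez] := f1 (f y).
  by move: (Ez x) (Ez y); rewrite !inE e eqxx => /esym/eqP-> /esym/eqP->.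
apply: (iffP forallP) => [q|[qL qR] a].
  split=> a; apply: inj => b.
    by have /forallP/(_ b)/andP[] := q a.
  by have /forallP/(_ b)/andP[] := q a.
by apply/forallP => b; rewrite (solve _ (qL a)) (solve _ (qR a)).
Qed.

Lemma medialP (T : finType) (op : binop T) :
  reflect (forall x y u v,
             op (op (x, y), op (u, v)) = op (op (x, u), op (y, v)))
          (medial op).
Proof.
apply: (iffP forallP) => [m x y u v|m x].
  by have /forallP/(_ y)/forallP/(_ u)/forallP/(_ v)/eqP := m x.
by do 3![apply/forallP => ?]; apply/eqP.
Qed.

Lemma quasigroup_isomorphic (T1 T2 : finType) (op1 : binop T1)
    (op2 : binop T2) :
  isomorphic op1 op2 -> quasigroup op2 -> quasigroup op1.
Proof.
case/isomorphicP=> f /bij_inj fI fM /quasigroupP[qL qR].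
by apply/quasigroupP; split=> a x y /(congr1 f); rewrite !fM;
  [move/qL/fI | move/qR/fI].
Qed.

Lemma medial_isomorphic (T1 T2 : finType) (op1 : binop T1) (op2 : binop T2) :
  isomorphic op1 op2 -> medial op2 -> medial op1.
Proof.
case/isomorphicP=> f /bij_inj fI fM /medialP m.
by apply/medialP => x y u v; apply: fI; rewrite !fM m.
Qed.

Lemma affine_form_isomorphic (G : finZmodType) (T1 T2 : finType)
    (op1 : binop T1) (op2 : binop T2) :
  isomorphic op1 op2 -> affine_form G op2 -> affine_form G op1.
Proof.
move=> iso12 /existsP[phi /andP[Aphi /existsP[psi /andP[Apsi /existsP[c
  iso2]]]]].
apply/existsP; exists phi; rewrite Aphi; apply/existsP; exists psi;
  rewrite Apsi.
by apply/existsP; exists c; apply: isomorphic_trans iso2.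
Qed.

(** Pulls an operation back along the enumerations; this moves operations between a group and the
    ordinal on which the classes are counted. *)
Lemma isomorphic_transport (T1 T2 : finType) (op2 : binop T2) :
  #|T1| = #|T2| -> exists op1 : binop T1, isomorphic op1 op2.
Proof.
move=> eqT; pose f x := enum_val (cast_ord eqT (enum_rank x)).
pose g y := enum_val (cast_ord (esym eqT) (enum_rank y)).
have fK : cancel f g by move=> x; rewrite /f /g enum_valK cast_ordK enum_rankK.
have gK : cancel g f by move=> x; rewrite /f /g enum_valK cast_ordKV enum_rankK.
exists [ffun xy => g (op2 (f xy.1, f xy.2))]; apply/isomorphicP.
by exists f => [|x y]; [exists g | rewrite ffunE gK].
Qed.

Lemma isomorphic_equivalence (K T : finType) (o : K -> binop T) :
  equivalence_rel (fun k l => isomorphic (o k) (o l)).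
Proof.
apply/equivalence_relP; split=> [k|k l kl m]; first exact: isomorphic_refl.
by apply/idP/idP; apply: isomorphic_trans => //; apply: isomorphic_sym.
Qed.

(** Each block is a fibre of [h] on [S], so blocks correspond one to one to values. *)
Lemma card_classes_invariant (T V : finType) (R : rel T) (S : {set T})
    (h : T -> V) :
    {in S &, forall x y, R x y = (h x == h y)} ->
  #|equivalence_partition R S| = #|h @: S|.
Proof.
move=> Rh; have blockE x : x \in S ->
    [set y in S | R x y] = [set y in S | h y == h x].
  move=> Sx; apply/setP => y; rewrite !inE.
  by case: (boolP (y \in S)) => // Sy; rewrite Rh // eq_sym.
have -> : equivalence_partition R S =
    (fun v => [set y in S | h y == v]) @: (h @: S).
  by rewrite -imset_comp; apply: eq_in_imset.
apply: card_in_imset => _ _ /imsetP[x Sx ->] /imsetP[y Sy ->] /setP/(_ x).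
by rewrite !inE Sx eqxx => /esym/eqP.
Qed.

Section EquivalenceClasses.

Variables (T : finType) (R : rel T).
Hypothesis eqR : equivalence_rel R.

Let Rrefl x : R x x. Proof. by have [] := eqR x x x. Qed.
Let Rtrans x y z : R x y -> R x z = R y z.
Proof. by move=> xy; have [_ ->] := eqR x y z. Qed.
Let Rsym x y : R x y = R y x.
Proof. by apply/idP/idP => h; rewrite -(Rtrans _ h) Rrefl. Qed.

Lemma equivalence_blockP (S : {set T}) :
  {in S &, forall x y, R x y = ([set z in S | R x z] == [set z in S | R y z])}.
Proof.
move=> x y Sx Sy; apply/idP/eqP => [xy|/setP/(_ y)].
  by apply/setP => z; rewrite !inE (Rtrans _ xy).
by rewrite !inE Sy Rrefl => /= ->.
Qed.

Lemma card_classes_split (S : {set T}) (P : pred T) :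
    {in S &, forall x y, R x y -> P x -> P y} ->
  #|equivalence_partition R S| =
    (#|equivalence_partition R [set x in S | P x]| +
     #|equivalence_partition R [set x in S | ~~ P x]|)%N.
Proof.
(* The block taken inside the whole of [S] serves as a common invariant for both halves, so their
   images can be compared as subsets of one set. *)
move=> PR; pose h x := [set z in S | R x z].
have hE (S' : {set T}) : S' \subset S ->
    {in S' &, forall x y, R x y = (h x == h y)}.
  by move=> /subsetP sS x y /sS Sx /sS Sy; apply: equivalence_blockP.
rewrite !(card_classes_invariant (hE _ _)) ?setIdE ?subsetIl // -cardsUI.
rewrite [X in (_ = _ + X)%N]eq_card0 ?addn0 => [|B].
  rewrite -imsetU -!setIdE (_ : _ :|: _ = S) //; apply/setP => x.
  by rewrite !inE -andb_orr orbN andbT.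
rewrite inE -!setIdE; apply/negP => /andP[/imsetP[x]].
rewrite inE => /andP[Sx Px] -> /imsetP[y]; rewrite inE => /andP[Sy nPy] /eqP;
  rewrite /h.
by rewrite -equivalence_blockP // => /PR/(_ Px)/idPn; apply.
Qed.

(** The counting principle behind all the normal forms: the invariant of [x] is the index of the
    only representative related to it, and these indices exhaust [N]. *)
Lemma card_classes_reps (S : {set T}) (K : finType) (N : {set K})
    (rep : K -> T) :
    {in N, forall k, rep k \in S} ->
    {in N &, forall k k', R (rep k) (rep k') -> k = k'} ->
    {in S, forall x, exists2 k, k \in N & R (rep k) x} ->
  #|equivalence_partition R S| = #|N|.
Proof.
move=> repS repI repR; pose h x := [pick k in N | R (rep k) x].
have hS x : x \in S -> exists k, [/\ h x = Some k, k \in N & R (rep k) x].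
  move=> Sx; rewrite /h; case: pickP => [k /andP[Nk kx]|no]; first by exists k.
  by have [k Nk kx] := repR x Sx; have := no k; rewrite Nk kx.
have hN k : k \in N -> h (rep k) = Some k.
  move=> Nk; have [k' [-> Nk' /repI->//]] := hS _ (repS k Nk).
rewrite (@card_classes_invariant _ _ _ _ h) => [|x y Sx Sy].
  rewrite -[RHS](card_imset _ Some_inj); apply: eq_card => o;
    apply/imsetP/imsetP => [[x /hS[k [-> Nk _] ->]]|[k Nk ->]].
    by exists k.
  by exists (rep k); rewrite ?repS ?hN.
have [[k [-> Nk kx]] [k' [-> Nk' ky]]] := (hS x Sx, hS y Sy).
rewrite -(Rtrans _ kx); apply/idP/eqP => [ky'|[->] //].
by congr Some; apply: repI => //; rewrite (Rtrans _ ky') Rsym.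
Qed.

End EquivalenceClasses.

(** The carriers [T] and [T'] differ, so an operation is compared with the family through the set of
    parameters isomorphic to it, which is a block of [S]. *)
Lemma num_iso_classes_param (T T' K : finType) (D : {set binop T})
    (S : {set K}) (o : K -> binop T') :
    {in S, forall k, exists2 op, op \in D & isomorphic op (o k)} ->
    {in D, forall op, exists2 k, k \in S & isomorphic op (o k)} ->
  num_iso_classes D =
    #|equivalence_partition (fun k k' => isomorphic (o k) (o k')) S|.
Proof.
move=> SD DS; pose h (op : binop T) := [set k in S | isomorphic op (o k)].
have hE op k : isomorphic op (o k) ->
    h op = [set k' in S | isomorphic (o k) (o k')].
  move=> iso; apply/setP => k'; rewrite !inE; congr (_ && _).
  by apply/idP/idP; apply: isomorphic_trans => //; apply: isomorphic_sym.
rewrite /num_iso_classes (@card_classes_invariant _ _ _ _ h).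
  apply: eq_card => B; apply/imsetP/imsetP.
    by case=> op Dop ->; have [k Sk /hE ->] := DS op Dop; exists k.
  by case=> k Sk ->; have [op Dop /hE <-] := SD k Sk; exists op.
move=> op op' Dop Dop'; have [k Sk iso] := DS op Dop.
apply/idP/eqP => [iso'|/setP/(_ k)].
  by rewrite !(hE _ k) //; apply: isomorphic_trans iso; apply: isomorphic_sym.
rewrite !inE Sk iso /= => /esym iso'.
by apply: isomorphic_trans iso (isomorphic_sym iso').
Qed.

(** Plain functions replace the permutations of [affine_op], so that multiplications and matrices
    can be used directly. *)
Definition aff (G : finZmodType) (phi psi : G -> G) (c : G) : binop G :=
  [ffun xy => phi xy.1 + psi xy.2 + c].
Lemma mem_Aut_add (G : finZmodType) (phi : {perm G}) :
  reflect {morph phi : x y / x + y} (phi \in Aut [set: G]).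
Proof.
rewrite inE; apply: (iffP andP) => [[_ /morphicP phiM] x y|phiM].
  by apply: phiM; rewrite inE.
split; first by apply/subsetP => x; rewrite inE.
by apply/morphicP => x y _ _; apply: phiM.
Qed.

Lemma affine_formP (G : finZmodType) (T : finType) (op : binop T) :
  reflect (exists phi psi : G -> G, exists c : G,
             [/\ injective phi, injective psi, {morph phi : x y / x + y},
                 {morph psi : x y / x + y} & isomorphic op (aff phi psi c)])
          (affine_form G op).
Proof.
apply: (iffP existsP).
  case=> phi /andP[/mem_Aut_add phiM /existsP[psi /andP[/mem_Aut_add psiM]]].
  by case/existsP=> c iso; exists phi, psi, c; split=> //; apply: perm_inj.
case=> phi [psi [c [phiI psiI phiM psiM iso]]].
exists (perm phiI); apply/andP; split.
  by apply/mem_Aut_add => x y; rewrite !permE.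
apply/existsP; exists (perm psiI); apply/andP; split.
  by apply/mem_Aut_add => x y; rewrite !permE.
apply/existsP; exists c; congr (isomorphic op _): iso.
by apply/ffunP => xy; rewrite !ffunE !permE.
Qed.

(** * Affine operations *)

Lemma morph_add0 (G H : zmodType) (f : G -> H) :
  {morph f : x y / x + y} -> f 0 = 0.
Proof. by move=> fM; apply: (addrI (f 0)); rewrite -fM !addr0. Qed.

Lemma morph_addN (G H : zmodType) (f : G -> H) :
  {morph f : x y / x + y} -> {morph f : x / - x}.
Proof.
by move=> fM x; apply: (addrI (f x)); rewrite -fM !subrr morph_add0.
Qed.

Lemma morph_addMn (G H : zmodType) (f : G -> H) n :
  {morph f : x y / x + y} -> {morph f : x / x *+ n}.
Proof.
by move=> fM x; elim: n => [|n IHn]; rewrite ?morph_add0 // !mulrS fM IHn.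
Qed.

(** Setting one variable to 0 shows that [A] and [B] differ from [f] by constants, and these cancel.
    It serves where a functional equation yields a splitting whose summands are unwieldy. *)
Lemma affine_of_additive_split (G H : zmodType) (f A B : G -> H) :
    (forall x y, f (x + y) = A x + B y) ->
  {morph (fun x => f x - f 0) : x y / x + y}.
Proof.
move=> fAB x y; have := fAB x 0; have := fAB 0 y; have := fAB 0 0.
rewrite !addr0 !add0r fAB => -> -> ->.
apply: (addIr (A 0 + B 0)); rewrite subrK -[in RHS]addrA subrK [in RHS]addrAC.
by rewrite [A 0 + B y]addrC addrACA [B 0 + _]addrC addrK.
Qed.

Section AffineOperations.

Variables G : finZmodType.
Implicit Types phi psi : G -> G.

Lemma aff_quasigroup phi psi c :
  injective phi -> injective psi -> quasigroup (aff phi psi c).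
Proof.
move=> phiI psiI; apply/quasigroupP.
split=> a x y; rewrite !ffunE /= => /addIr; first by move/addrI/psiI.
by move/addIr/phiI.
Qed.

(** At the quadruple 0, x, 0, 0 mediality reads [phi (psi x)] on one side and [psi (phi x)] on the
    other, plus the same constants. *)
Lemma aff_medial phi psi c :
    {morph phi : x y / x + y} -> {morph psi : x y / x + y} ->
  reflect (forall x, phi (psi x) = psi (phi x)) (medial (aff phi psi c)).
Proof.
move=> phiM psiM; apply: (iffP (medialP _)) => [m x|C x y u v].
  have := m 0 x 0 0; rewrite !ffunE /= !phiM !psiM.
  rewrite !(morph_add0 psiM, morph_add0 phiM, addr0, add0r) !addrA.
  by rewrite [phi c + _]addrC => /addIr/addIr/addIr.
rewrite !ffunE /= !phiM !psiM !C -!addrA; congr (_ + _).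
rewrite [LHS]addrCA [RHS]addrCA; congr (_ + _).
by rewrite addrCA.
Qed.

End AffineOperations.

Lemma aff_isomorphicP (G H : finZmodType) (phi psi : G -> G) (c : G)
    (phi' psi' : H -> H) (c' : H) :
    injective phi -> injective psi ->
    {morph phi : x y / x + y} -> {morph psi : x y / x + y} ->
    {morph phi' : x y / x + y} -> {morph psi' : x y / x + y} ->
  reflect (exists g : G -> H, exists t : H,
             [/\ bijective g, {morph g : x y / x + y},
                 {morph g : x / phi x >-> phi' x},
                 {morph g : x / psi x >-> psi' x} &
                 g c + t = phi' t + psi' t + c'])
          (isomorphic (aff phi psi c) (aff phi' psi' c')).
Proof.
move=> phiI psiI phiM psiM phiM' psiM'.
apply: (iffP (isomorphicP _ _)) => [[f bf fM]|[g [t [bg gM gphi gpsi gc]]]].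
  pose t := f 0; pose g x := f x - t.
  have fE x : f x = g x + t by rewrite subrK.
  have [phiV _ phiK] := injF_bij phiI; have [psiV _ psiK] := injF_bij psiI.
  have gM : {morph g : x y / x + y}.
    (* Every sum x + y is a product, namely of [phiV x] and [psiV (y - c)]; applying [f] splits it
       into a function of x plus a function of y. *)
    apply: (@affine_of_additive_split _ _ f (fun z => phi' (f (phiV z)))
              (fun z => psi' (f (psiV (z - c))) + c')) => x y.
    have := fM (phiV x) (psiV (y - c)); rewrite !ffunE /= phiK psiK.
    by rewrite -addrA subrK addrA.
  have g0 := morph_add0 gM.
  have phi0 := morph_add0 phiM; have psi0 := morph_add0 psiM.
  have phi0' := morph_add0 phiM'; have psi0' := morph_add0 psiM'.
  have gc : g c + t = phi' t + psi' t + c'.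
    by have := fM 0 0; rewrite !ffunE /= phi0 psi0 !add0r !fE g0 !add0r.
  (* With the constants cancelled the variables separate: [y = 0] gives the intertwining for [phi],
     and [x = 0] the one for [psi]. *)
  have gE x y : g (phi x) + g (psi y) = phi' (g x) + psi' (g y).
    apply: (addIr (g c + t)); have := fM x y; rewrite !ffunE /= !fE !gM => e.
    by rewrite addrA e gc phiM' psiM' !addrA; congr (_ + _ + _); rewrite addrAC.
  exists g, t; split=> //.
  - have [fV fK fVK] := bf.
    by exists (fun y => fV (y + t)) => x; rewrite /g ?subrK ?fK // fVK addrK.
  - by move=> x; have := gE x 0; rewrite psi0 g0 psi0' !addr0.
  - by move=> x; have := gE 0 x; rewrite phi0 g0 phi0' !add0r.
have [gV gK gVK] := bg; exists (fun x => g x + t) => [|x y].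
  by exists (fun y => gV (y - t)) => x; rewrite ?addrK ?gK // gVK subrK.
rewrite !ffunE /= !gM gphi gpsi phiM' psiM' -[LHS]addrA gc.
by rewrite [LHS]addrA [in LHS]addrACA.
Qed.

Lemma affine_form_additive_bij (G H : finZmodType) (g : G -> H) (T : finType)
    (op : binop T) :
    bijective g -> {morph g : x y / x + y} ->
  affine_form G op -> affine_form H op.
Proof.
move=> [h gK hK] gM /affine_formP[phi [psi [c [phiI psiI phiM psiM iso]]]].
have hM : {morph h : x y / x + y}.
  by move=> x y; apply: (can_inj gK); rewrite gM !hK.
apply/affine_formP; exists (g \o phi \o h), (g \o psi \o h), (g c).
have [gI hI] := (can_inj gK, can_inj hK).
split; do ?by [apply: inj_comp hI; apply: inj_comp|
               move=> x y /=; rewrite hM ?phiM ?psiM gM].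
apply: isomorphic_trans iso _; apply/isomorphicP; exists g; first by exists h.
by move=> x y; rewrite !ffunE /= !gM !gK.
Qed.

Lemma affine_form_eq (G H : finZmodType) (g : G -> H) (T : finType)
    (op : binop T) :
    bijective g -> {morph g : x y / x + y} ->
  affine_form G op = affine_form H op.
Proof.
move=> bg gM; apply/idP/idP; first exact: affine_form_additive_bij gM.
case: bg => h gK hK; apply: (@affine_form_additive_bij _ _ h);
  first by exists g.
by move=> x y; apply: (can_inj gK); rewrite gM !hK.
Qed.

(** The linear part of the isomorphism between the two affine forms is an isomorphism of groups, so
    a quasigroup determines the group of its affine forms. *)
Lemma affine_form_group_unique (G H : finZmodType) (T : finType) (op : binop T)
  :
    affine_form G op -> affine_form H op ->
  exists2 g : G -> H, bijective g & {morph g : x y / x + y}.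
Proof.
case/affine_formP=> phi [psi [c [phiI psiI phiM psiM iso]]].
case/affine_formP=> phi' [psi' [c' [_ _ phiM' psiM' iso']]].
have /aff_isomorphicP := isomorphic_trans (isomorphic_sym iso) iso'.
by case=> // g [t [bg gM _ _ _]]; exists g.
Qed.

(** * Medial quasigroups are affine *)

Lemma finZmod_of_group (T : finType) (add : T -> T -> T) (e : T) (opp : T -> T) :
    associative add -> commutative add -> left_id e add ->
    left_inverse e opp add ->
  exists (G : finZmodType) (f : T -> G),
    bijective f /\ {morph f : x y / add x y >-> x + y}.
Proof.
move=> addA addC add0x addNx.
pose G : finZmodType :=
  HB.pack (Finite.sort T) (GRing.isZmodule.Build T addA addC add0x addNx).
by exists G, id; split=> //; exists id.
Qed.

(** The group is the loop isotope of [op] at [z]: with respect to [add], whose neutral element is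
    [e], the operation is [alpha x] plus [beta y]. Mediality makes this loop an abelian group and
    both maps affine; [h] is the linear part of [alpha]. *)
Lemma toyoda (T : finType) (op : binop T) (z : T) :
    quasigroup op -> medial op ->
  exists2 G : finZmodType, #|G| = #|T| & affine_form G op.
Proof.
move=> /quasigroupP[qL qR] /medialP m.
pose alpha x : T := op (x, z); pose beta x : T := op (z, x).
have alphaI : injective alpha by apply: qR.
have betaI : injective beta by apply: qL.
have [ai aiK aK] := injF_bij alphaI; have [bi biK bK] := injF_bij betaI.
pose add x y : T := op (ai x, bi y); pose e : T := op (z, z).
have opE x y : op (x, y) = add (alpha x) (beta y) by rewrite /add aiK biK.
have add0x : left_id e add by move=> x; rewrite /add -[e]/(alpha z) aiK;
  apply: bK.
have addx0 : right_id e add by move=> x; rewrite /add -[e]/(beta z) biK;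
  apply: aK.
have addI x : injective (add x) by move=> y y' /qL/(can_inj bK).
have addR x y : exists w, add x w = y.
  by have [v _ vK] := injF_bij (@addI x); exists (v y).
pose delta x := alpha (bi x).
(* Mediality read in the loop [add], with alpha and beta absorbed. *)
have key x y u v : add (alpha (add x y)) (beta (add (delta u) v)) =
                   add (alpha (add x u)) (beta (add (delta y) v)).
  by have := m (ai x) (bi y) (bi u) (bi v); rewrite !opE !aK !bK.
(* Chosen so that the [beta] factor in [key] becomes neutral at [u = e]; then [key] says that
   [alpha] turns a sum into [alpha x] plus [h y]. *)
have [v0 v0E] := addR (delta e) (bi e).
pose h y := beta (add (delta y) v0).
have h0 : h e = e by rewrite /h v0E bK.
have alphaD x y : alpha (add x y) = add (alpha x) (h y).
  by have := key x y e v0; rewrite v0E bK !addx0.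
have deltaI : injective delta by move=> x y /alphaI/(can_inj bK).
have hI : injective h.
  move=> x y /betaI; rewrite /add => /qR/(can_inj aK)/deltaI//.
have [hi hK hiK] := injF_bij hI.
(* [key] at [v = v0], with arguments chosen through the inverses of [alpha] and [h]. Together with
   the neutral element, this one exchange law gives both commutativity and associativity. *)
have addAC X Y U : add (add X Y) U = add (add X U) Y.
  have := key (ai X) (hi Y) (hi U) v0.
  by rewrite !alphaD aK -!/(h _) !hiK.
have addC : commutative add by move=> x y; rewrite -[x in LHS]add0x addAC add0x.
have addA : associative add.
  by move=> x y u; rewrite [RHS]addAC addC [add y u]addC addAC [add u x]addC.
have addN : left_inverse e (fun x => invF (@addI x) e) add.
  by move=> x; rewrite addC; apply: (f_invF (@addI x)).
have [G [f [bf fM]]] := finZmod_of_group addA addC add0x addN.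
have f0 : f e = 0 by apply: (addrI (f e)); rewrite -fM add0x addr0.
have alphaE x : alpha x = add (alpha e) (h x) by rewrite -[x in LHS]add0x
  alphaD.
have hM : {morph h : x y / add x y}.
  move=> x y; apply: (@addI (alpha e)).
  by rewrite -alphaE alphaD [alpha x]alphaE addA.
have [di dK diK] := injF_bij deltaI.
(* [key] at [x = y = e] splits [beta (add w v)] into a function of w and a function of v, so [beta]
   is affine and [psi] below is additive. *)
have betaD w v : beta (add w v) = add (h (di w)) (beta (add (delta e) v)).
  have := key e e (di w) v; rewrite !diK !add0x => e1.
  by apply: (@addI (alpha e)); rewrite e1 [alpha (di w)]alphaE addA.
have [g gK gfK] := bf.
pose phi x := f (h (g x)); pose psi x := f (beta (g x)) - f (beta e).
have gM x y : g (x + y) = add (g x) (g y).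
  by apply: (can_inj gK); rewrite fM !gfK.
have phiM : {morph phi : x y / x + y} by move=> x y; rewrite /phi gM hM fM.
have psiM : {morph psi : x y / x + y}.
  have g0 : e = g 0 by rewrite -f0 gK.
  rewrite /psi g0; apply: (@affine_of_additive_split _ _ (fun x =>
    f (beta (g x)))
    (fun x => f (h (di (g x)))) (fun y => f (beta (add (delta e) (g y))))).
  by move=> x y; rewrite gM betaD fM.
exists G; first by rewrite (bij_eq_card bf).
apply/affine_formP; exists phi, psi, (f (alpha e) + f (beta e)).
have [fI gI] := (can_inj gK, can_inj gfK).
split=> //; first by move=> x y /fI/hI/gI.
  by move=> x y /addIr/fI/betaI/gI.
apply/isomorphicP; exists f => // x y; rewrite opE !ffunE /= /phi /psi !gK.
by rewrite alphaE !fM addrACA subrK [f (alpha e) + _]addrC.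
Qed.

(** * Abelian groups of order p^2 *)

Lemma morph_add_inj (G H : zmodType) (f : G -> H) :
  {morph f : x y / x + y} -> (forall x, f x = 0 -> x = 0) -> injective f.
Proof.
move=> fM f0 x y e; apply/eqP; rewrite -subr_eq0; apply/eqP/f0.
by apply: (addIr (f y)); rewrite -fM subrK add0r.
Qed.

Lemma mulrn_order (G : finZmodType) (x : G) : x *+ #[x]%g = 0.
Proof. by rewrite -FinRing.zmodXgE expg_order. Qed.

Lemma mulrn_eq0_order (G : finZmodType) (x : G) n :
  (x *+ n == 0) = (#[x]%g %| n)%N.
Proof. by rewrite order_dvdn FinRing.zmodXgE. Qed.

Lemma order_dvd_card (G : finZmodType) (x : G) : (#[x]%g %| #|G|)%N.
Proof. by rewrite -cardsT order_dvdG ?inE. Qed.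

Lemma mulrn_mod (G : zmodType) (x : G) d n :
  x *+ d = 0 -> x *+ (n %% d) = x *+ n.
Proof.
by move=> xd; rewrite {2}(divn_eq n d) mulrnDr mulnC mulrnA xd mul0rn add0r.
Qed.

(** Either some element has order p^2 and generates, or every nonzero element has order p. Then x
    and any y outside its span generate cycles of prime order meeting trivially, and cardinality
    gives bijectivity. *)
Lemma finZmod_order_sqr_prime (p : nat) (G : finZmodType) :
    prime p -> #|G| = (p ^ 2)%N ->
  (exists2 f : 'Z_(p ^ 2) -> G, bijective f & {morph f : x y / x + y}) \/
  (exists2 f : 'Z_p * 'Z_p -> G, bijective f & {morph f : x y / x + y}).
Proof.
move=> p_pr oG; have p_gt1 := prime_gt1 p_pr.
have p2_gt1 : (1 < p ^ 2)%N by rewrite -(exp1n 2) ltn_exp2r.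
have [x /eqP ox|no] := pickP [pred x : G | #[x]%g == (p ^ 2)%N].
  (* [(Zp_trunc (p ^ 2)).+2] is the modulus built into the type; it equals p^2 because p^2 exceeds
     1. *)
  left; have xn : x *+ (Zp_trunc (p ^ 2)).+2 = 0 by rewrite Zp_cast // -ox
    mulrn_order.
  pose f (k : 'Z_(p ^ 2)) := x *+ k.
  have fM : {morph f : k l / k + l}.
    by move=> k l; rewrite /f -mulrnDr /= mulrn_mod.
  exists f => //; apply: inj_card_bij; last by rewrite oG card_ord Zp_cast.
  apply: (morph_add_inj fM) => k /eqP;
    rewrite mulrn_eq0_order ox => /dvdnP[q kE].
  apply/val_inj => /=; have := ltn_ord k; rewrite [X in (_ < X)%N]Zp_cast // kE.
  by rewrite -{2}[(p ^ 2)%N]mul1n ltn_pmul2r ?(ltnW p2_gt1) //; case: q kE.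
right; have xp (x : G) : x *+ p = 0.
  apply/eqP; rewrite mulrn_eq0_order.
  have := order_dvd_card x; rewrite oG =>
    /(dvdn_pfactor _ _ p_pr)[[|[|[|//]]] _ ox].
  - by rewrite ox dvd1n.
  - by rewrite ox.
  - by have := no x; rewrite /= ox eqxx.
have oxp (x : G) : x != 0 -> #[x]%g = p.
  move=> x0; have /eqP := xp x; rewrite mulrn_eq0_order.
  by move/(prime_nt_dvdP p_pr) => -> //; rewrite order_eq1.
have [x x0] : exists x : G, x != 0.
  have: (1 < #|[set: G]|)%N by rewrite cardsT oG.
  by case/card_gt1P=> x [y [_ _ xy]]; case: (eqVneq x 0) xy => [->|?];
     [exists y; rewrite eq_sym | exists x].
have [y xy] : exists y, y \notin <[x]>%g.
  have: ~~ ([set: G] \subset <[x]>%g).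
    apply/negP => /subset_leq_card; rewrite cardsT oG -orderE oxp //.
    by rewrite leqNgt -{1}[p]expn1 ltn_exp2l.
  by case/subsetPn=> y _ xy; exists y.
have y0 : y != 0 by apply: contraNneq xy => ->; apply: group1.
have TIxy : (<[y]> :&: <[x]> = 1)%g.
  by apply: prime_TIg; rewrite -?orderE ?oxp ?cycle_subG.
pose f (k : 'Z_p * 'Z_p) := x *+ k.1 + y *+ k.2.
have fM : {morph f : k l / k + l}.
  have xp' (u : G) : u *+ (Zp_trunc p).+2 = 0 by rewrite Zp_cast.
  by move=> k l; rewrite /f addrACA -!mulrnDr /= !(mulrn_mod _ (xp' _)).
exists f => //; apply: inj_card_bij; last first.
  by rewrite oG card_prod card_ord Zp_cast.
have k0 (k : 'Z_p) (u : G) : u != 0 -> u *+ k = 0 -> k = 0.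
  move=> u0 /eqP; rewrite mulrn_eq0_order oxp //.
  have kp : (k < p)%N by rewrite -{2}(Zp_cast p_gt1).
  case: (posnP k) => [k_0 _|k_gt0 /dvdn_leq]; first exact/val_inj.
  by move/(_ k_gt0); rewrite leqNgt kp.
apply: (morph_add_inj fM) => -[k l]; rewrite /f /= => e.
have: y *+ l \in (<[y]> :&: <[x]>)%g.
  rewrite inE -[y *+ l]FinRing.zmodXgE mem_cycle /= FinRing.zmodXgE.
  by rewrite -(addrK (x *+ k) (y *+ l)) addrC [_ + x *+ k]addrC e addr0 groupV
    mem_cycle.
rewrite TIxy => /set1gP yl; rewrite yl addr0 in e.
by rewrite (k0 _ _ x0 e) (k0 _ _ y0 yl).
Qed.

(** Multiplication by p kills the plane but not the element 1 of the cyclic group. *)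
Lemma Zp_sqr_not_isog (p : nat) (f : 'Z_(p ^ 2) -> 'Z_p * 'Z_p) :
  (1 < p)%N -> injective f -> ~ {morph f : x y / x + y}.
Proof.
move=> p_gt1 fI fM; have p2_gt1 : (1 < p ^ 2)%N by rewrite -(exp1n 2) ltn_exp2r.
have pZp (a : 'Z_p) : a *+ p = 0 by rewrite -mulr_natr pchar_Zp ?mulr0.
have: (p%:R : 'Z_(p ^ 2)) = 0.
  apply: fI; rewrite (morph_add0 fM) [f _]surjective_pairing.
  have f1M : {morph (fun x => (f x).1) : x y / x + y} by move=> x y; rewrite fM.
  have f2M : {morph (fun x => (f x).2) : x y / x + y} by move=> x y; rewrite fM.
  by rewrite (morph_addMn _ f1M) (morph_addMn _ f2M) !pZp.
move/(congr1 val); rewrite /= val_Zp_nat // modn_small => [p0|].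
  by rewrite p0 in p_gt1.
by rewrite -{1}[p]expn1 ltn_exp2l.
Qed.

(** Puts the classes over both groups on the same carrier ['I_n], where they can be compared and
    added. *)
Lemma mq_over_card (G : finZmodType) (n : nat) :
  #|G| = n ->
  mq_over G = num_iso_classes [set op : binop 'I_n
                              | [&& quasigroup op, medial op & affine_form G
                                op]].
Proof. by move=> <-. Qed.

Lemma mq_over_param (G : finZmodType) (K : finType) (S : {set K})
    (o : K -> binop G) :
    {in S, forall k, [&& quasigroup (o k),
      medial (o k) & affine_form G (o k)]} ->
    (forall op : binop G,
       [&& quasigroup op, medial op & affine_form G op] ->
       exists2 k, k \in S & isomorphic op (o k)) ->
  mq_over G =
    #|equivalence_partition (fun k k' => isomorphic (o k) (o k')) S|.
Proof.
move=> So oS; apply: num_iso_classes_param => [k Sk|op].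
  have [op iso] := isomorphic_transport (o k) (card_ord #|G|).
  exists op => //; have /and3P[q m a] := So k Sk.
  by rewrite inE (quasigroup_isomorphic iso) // (medial_isomorphic iso) //
             (affine_form_isomorphic iso).
rewrite inE => /and3P[q m a].
have [op' iso] := isomorphic_transport op (esym (card_ord #|G|)).
have [|k Sk iso'] := oS op'.
  by rewrite (quasigroup_isomorphic iso) // (medial_isomorphic iso) //
             (affine_form_isomorphic iso).
by exists k => //; apply: isomorphic_trans (isomorphic_sym iso) iso'.
Qed.

(** Having an affine form over the cyclic group is invariant. Its negation means having one over the
    plane: Toyoda's theorem and the classification of groups give one direction, uniqueness of the
    group the other. *)
Lemma mq_sqr_prime (p : nat) :
  prime p -> mq (p ^ 2) = (mq_over 'Z_(p ^ 2) + mq_over ('Z_p * 'Z_p)%type)%N.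
Proof.
move=> p_pr; have p_gt1 := prime_gt1 p_pr.
have p2_gt1 : (1 < p ^ 2)%N by rewrite -(exp1n 2) ltn_exp2r.
rewrite (@mq_over_card _ (p ^ 2)) ?card_ord ?Zp_cast //.
rewrite (@mq_over_card _ (p ^ 2)) ?card_prod ?card_ord ?Zp_cast //.
rewrite /mq /num_iso_classes.
rewrite (card_classes_split (@isomorphic_equivalence _ 'I_(p ^ 2) id)
          (P := @affine_form 'Z_(p ^ 2) 'I_(p ^ 2))); last first.
  by move=> op op' _ _ /isomorphic_sym; apply: affine_form_isomorphic.
congr addn; apply: (congr1 (fun D : {set binop 'I_(p ^ 2)} =>
                              #|equivalence_partition (@isomorphic _ _) D|)).
  by apply/setP => op; rewrite !inE andbA.
apply/setP => op; rewrite !inE [RHS]andbA; apply: andb_id2l => /andP[q m].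
apply/idP/idP => [nZ|aZZ]; last first.
  by apply/negP => /affine_form_group_unique/(_ aZZ)[g /bij_inj
    /Zp_sqr_not_isog]; apply.
(* The base point at which the loop isotope is formed. *)
have z : 'I_(p ^ 2) by exists 0%N; apply: ltnW.
have [G] := toyoda z q m; rewrite card_ord => oG aG.
have [[f bf fM]|[f bf fM]] := finZmod_order_sqr_prime p_pr oG.
  by rewrite (affine_form_eq _ bf fM) aG in nZ.
by rewrite (affine_form_eq _ bf fM).
Qed.

(** * Quasigroups over the cyclic group *)

Lemma card_pair_sum (X Y : finType) (P : pred (X * Y)) :
  #|[set z | P z]| = (\sum_x #|[set y | P (x, y)]|)%N.
Proof.
rewrite -sum1dep_card; under [RHS]eq_bigr => x _ do rewrite -sum1dep_card.
by rewrite pair_big_dep /=; apply: eq_bigl => -[].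
Qed.

Lemma sum_nat_pred (T : finType) (P : pred T) :
  (\sum_x P x = #|[set x | P x]|)%N.
Proof. by rewrite -sum1dep_card [RHS]big_mkcond; apply: eq_bigr => x _;
  case: P. Qed.

Lemma card_fibers (X Y : finType) (P : pred X) (Q : X -> pred Y) (m : nat) :
    (forall x, P x -> #|[set y | Q x y]| = m) ->
  #|[set z : X * Y | P z.1 && Q z.1 z.2]| = (#|[set x | P x]| * m)%N.
Proof.
move=> Qm; rewrite card_pair_sum -sum_nat_cond_const [RHS]big_mkcond.
apply: eq_bigr => x _ /=; case: ifP => [Px|_]; last by apply: eq_card0 => y;
  rewrite !inE.
by rewrite -(Qm x Px); apply: eq_card => y; rewrite !inE.
Qed.

Section CyclicCount.

Variable p : nat.
Hypothesis p_pr : prime p.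
Notation n := (p ^ 2)%N.
Notation Zn := 'Z_(p ^ 2).

Definition Zop (k : Zn * Zn * Zn) : binop Zn :=
  aff ( *%R k.1.1) ( *%R k.1.2) k.2.

Definition Zparam : {set Zn * Zn * Zn} :=
  [set k | (k.1.1 \is a GRing.unit) && (k.1.2 \is a GRing.unit)].

Lemma Zn_additive (f : Zn -> Zn) :
  {morph f : x y / x + y} -> forall x, f x = f 1 * x.
Proof. by move=> fM x; rewrite -{1}(natr_Zp x) morph_addMn // -mulr_natr
  natr_Zp. Qed.

Lemma Zn_additive_unit (f : Zn -> Zn) :
  {morph f : x y / x + y} -> injective f -> f 1 \is a GRing.unit.
Proof.
move=> fM /injF_bij[g _ gK]; apply/unitrPr; exists (g 1).
by rewrite -Zn_additive // gK.
Qed.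

(** The automorphisms are multiplications by units and commute, so both coefficients are invariant
    and only the constant can move. *)
Lemma Zop_isomorphicP k l :
    k \in Zparam -> l \in Zparam ->
  reflect (k.1 = l.1 /\ exists2 u, u \is a GRing.unit &
             exists t, u * k.2 + t = l.1.1 * t + l.1.2 * t + l.2)
          (isomorphic (Zop k) (Zop l)).
Proof.
case: k l => [[a b] c] [[a' b'] c'];
  rewrite !inE /= => /andP[Ua Ub] /andP[Ua' Ub'].
apply: (iffP (aff_isomorphicP _ _ (mulrI Ua) (mulrI Ub) (mulrDr a) (mulrDr b)
  (mulrDr a') (mulrDr b'))).
  case=> g [t [/bij_inj gI gM ga gb gc]].
  have Ug := Zn_additive_unit gM gI; have gE := Zn_additive gM.
  split; last by exists (g 1) => //; exists t; rewrite -gE.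
  have [ga1 gb1] := (ga 1, gb 1).
  rewrite mulr1 gE mulrC in ga1; rewrite mulr1 gE mulrC in gb1.
  by rewrite (mulIr Ug ga1) (mulIr Ug gb1).
case=> -[-> ->] [u Uu [t e]]; exists ( *%R u), t; split=> //.
- by apply: injF_bij; apply: mulrI.
- exact: mulrDr.
- by move=> x; rewrite mulrCA.
- by move=> x; rewrite mulrCA.
Qed.

Lemma mq_over_Zn :
  mq_over Zn =
    #|equivalence_partition (fun k l => isomorphic (Zop k) (Zop l)) Zparam|.
Proof.
apply: mq_over_param => [k|op /and3P[_ m /affine_formP]].
  rewrite inE => /andP[Ua Ub]; apply/and3P; split.
  - by apply: aff_quasigroup; apply: mulrI.
  - by apply/(aff_medial _ (mulrDr _) (mulrDr _)) => x; rewrite mulrCA.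
  - apply/affine_formP; exists ( *%R k.1.1), ( *%R k.1.2), k.2.
    by split; [apply: mulrI|apply: mulrI|apply: mulrDr|apply: mulrDr|apply:
      isomorphic_refl].
case=> phi [psi [c [phiI psiI phiM psiM iso]]].
exists (phi 1, psi 1, c); first by rewrite inE /= !Zn_additive_unit.
congr (isomorphic op _): iso; apply/ffunP => xy.
by rewrite !ffunE /= -!Zn_additive.
Qed.

Let p_gt1 : (1 < p)%N := prime_gt1 p_pr.
Let n_gt1 : (1 < n)%N. Proof. by rewrite -(exp1n 2) ltn_exp2r. Qed.

Lemma Zn_unitE (x : Zn) : (x \is a GRing.unit) = ~~ (p %| x)%N.
Proof. by rewrite -{1}(natr_Zp x) unitZpE // coprime_pexpl // prime_coprime.
  Qed.

Lemma Zn_nonunitP (x : Zn) :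
  reflect (exists y, x = p%:R * y) (x \isn't a GRing.unit).
Proof.
rewrite Zn_unitE negbK; apply: (iffP idP) => [/dvdnP[q xE]|[y ->]].
  by exists q%:R; rewrite -[x]natr_Zp xE -natrM mulnC.
have := Zn_unitE (p%:R * y); rewrite unitrM unitZpE // coprime_pexpl //.
by rewrite prime_coprime // dvdnn /= => /esym/negbFE.
Qed.

Lemma card_Zn_unit : #|[set x : Zn | x \is a GRing.unit]| = (p * p.-1)%N.
Proof.
have := @card_units_Zp n (ltnW n_gt1);
  rewrite cardsT card_sub totient_pfactor //.
by rewrite expn1 mulnC cardsE => <-.
Qed.

Let w : Zn := p%:R.
Let ww : w * w = 0. Proof. by rewrite -natrM mulnn pchar_Zp. Qed.
Let w_neq0 : w != 0.
Proof.
apply/eqP => /(congr1 val)/eqP;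
  rewrite /= val_Zp_nat // modn_small ?eqn0Ngt ?(ltnW p_gt1) //.
by rewrite -{1}[p]expn1 ltn_exp2l.
Qed.

(** Non-units are multiples of [w], hence of square zero, and do not affect invertibility when
    added. *)
Lemma Zn_unitD_nonunit (u x : Zn) :
  x \isn't a GRing.unit -> (u + x \is a GRing.unit) = (u \is a GRing.unit).
Proof.
have unitD (v y : Zn) : y \isn't a GRing.unit -> v \is a GRing.unit ->
    v + y \is a GRing.unit.
  move=> /Zn_nonunitP[z ->] Uv; apply/unitrPr.
  (* The inverse comes from (v + wz)(v - wz) = v^2, as [w * w = 0]. *)
  exists ((v - w * z) / (v * v)); rewrite mulrA.
  rewrite (_ : (_ + _) * _ = v * v - w * w * z * z); last by rewrite /w; ring.
  by rewrite ww !mul0r subr0 divrr // unitrM Uv.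
move=> nx; apply/idP/idP => [Uux|]; last exact: unitD.
by rewrite -(addrK x u) unitD // unitrN.
Qed.

Lemma card_Zn_nonunit : #|[set x : Zn | x \isn't a GRing.unit]| = p.
Proof.
have cardZn : #|{: Zn}| = (p * p.-1 + p)%N.
  by rewrite card_ord Zp_cast // addnC -mulnS prednK ?mulnn // ltnW.
have := cardsC [set x : Zn | x \is a GRing.unit].
rewrite card_Zn_unit cardZn => /addnI e; rewrite -[RHS]e.
by apply: eq_card => x; rewrite !inE.
Qed.

(** If 1 - x is a non-unit, then x is automatically a unit, so exactly p of the p(p - 1) units are
    excluded. *)
Lemma card_Zn_unit_1B :
  #|[set x : Zn | (x \is a GRing.unit) && (1 - x \is a GRing.unit)]| =
    (p * p.-2)%N.
Proof.
have := cardsID [set x : Zn | 1 - x \is a GRing.unit] [set x | x \is a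
  GRing.unit].
rewrite card_Zn_unit [X in (_ + X)%N](_ : _ = p); last first.
  rewrite -[RHS]card_Zn_nonunit -[RHS](@card_imset _ _ (fun x : Zn => 1 - x)).
    apply: eq_card => x; rewrite !inE; apply/idP/imsetP => [/andP[nx Ux]|[y]].
      by exists (1 - x); rewrite ?inE // opprB addrCA subrr addr0.
    rewrite inE => ny ->; rewrite opprB addrCA subrr addr0 ny.
    by rewrite Zn_unitD_nonunit ?unitrN ?unitr1.
  by move=> x y /addrI/oppr_inj.
have -> : (p * p.-1 = p * p.-2 + p)%N.
  by rewrite addnC -mulnS; case: p p_gt1 => [|[]].
move/addIn => e; rewrite -[RHS]e.
by apply: eq_card => x; rewrite !inE.
Qed.

(* With d = 1 - a - b, translations change c by multiples of d and automorphisms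
   by units, so the class of c is an ideal of Zn / (d): the chain of ideals
   (1), (w), (0) leaves the generators 1, w, 0 not already killed by d. *)
Definition Zrep : {set Zn * Zn * Zn} :=
  [set k | (k \in Zparam) &&
    let d := 1 - k.1.1 - k.1.2 in
    [|| k.2 == 0, (k.2 == 1) && (d \isn't a GRing.unit) | (k.2 == w) && (d ==
      0)]].

Lemma Zop_isomorphic_rep k : k \in Zparam ->
  exists2 l, l \in Zrep & isomorphic (Zop l) (Zop k).
Proof.
case: k => [[a b] c] Pk; have := Pk; rewrite inE /= => /andP[Ua Ub].
pose d := 1 - a - b.
suff [c' Nc [u Uu [t e]]]: exists2 c', (a, b, c') \in Zrep &
    exists2 u, u \is a GRing.unit & exists t, u * c' + d * t = c.
  exists (a, b, c') => //; apply/Zop_isomorphicP => //.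
    by move: Nc; rewrite inE => /andP[].
  by split=> //; exists u => //; exists t; rewrite /= -e /d; ring.
have Nrep c' : (a, b, c') \in Zrep =
    [|| c' == 0, (c' == 1) && (d \isn't a GRing.unit) | (c' == w) && (d == 0)].
  by rewrite inE inE /= Ua Ub.
have [Ud|nd] := boolP (d \is a GRing.unit).
  exists 0; first by rewrite Nrep eqxx.
  by exists 1; rewrite ?unitr1 //; exists (d^-1 * c);
    rewrite mulr0 add0r mulrA divrr // mul1r.
have [Uc|/Zn_nonunitP[z cE]] := boolP (c \is a GRing.unit).
  exists 1; first by rewrite Nrep eqxx nd orbT.
  by exists c => //; exists 0; rewrite mulr1 mulr0 addr0.
have [d0|dn0] := eqVneq d 0.
  have [c0|cn0] := eqVneq c 0.
    exists 0; first by rewrite Nrep eqxx.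
    by exists 1; rewrite ?unitr1 //; exists 0; rewrite c0 !mulr0 addr0.
  exists w; first by rewrite Nrep eqxx d0 eqxx !orbT.
  exists z; last by exists 0; rewrite mulr0 addr0 cE mulrC.
  apply: contraR cn0 => /Zn_nonunitP[y zE].
  by rewrite cE zE mulrA -/w ww mul0r.
(* Remaining case: d is [w] times a unit, so its multiples are all the non-units, and the non-unit c
   can be translated to 0. *)
have /Zn_nonunitP[y dE] := nd.
have Uy : y \is a GRing.unit.
  apply: contraR dn0 => /Zn_nonunitP[x yE].
  by rewrite dE yE mulrA -/w ww mul0r.
exists 0; first by rewrite Nrep eqxx.
exists 1; rewrite ?unitr1 //; exists (y^-1 * z).
by rewrite mulr0 add0r dE cE mulrA mulrK.
Qed.

Lemma Zrep_inj : {in Zrep &, forall k l, isomorphic (Zop k) (Zop l) -> k = l}.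
Proof.
have Nw : w \isn't a GRing.unit by apply/Zn_nonunitP; exists 1; rewrite mulr1.
have N0 : (0 : Zn) \isn't a GRing.unit by rewrite unitr0.
move=> [[a b] c] [[a' b'] c']; rewrite ![_ \in Zrep]inE /=.
move=> /andP[Pk Ck] /andP[Pl Cl] /(Zop_isomorphicP Pk Pl)[/= [e1 e2]].
move: Pk Pl Ck Cl; rewrite -e1 -e2 => _ _.
set d := 1 - a - b => Ck Cl [u Uu [t e]]; congr (_, _).
have {}e : u * c + d * t = c'.
  by apply: (addIr (a * t + b * t)); rewrite [RHS]addrC -e /d; ring.
have [Ud|nd] := boolP (d \is a GRing.unit).
  have d0 : (d == 0) = false by apply: contraTF Ud => /eqP->.
  by move: Ck Cl; rewrite Ud d0 !andbF !orbF => /eqP-> /eqP->.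
(* Modulo the non-unit d, being a unit is invariant and separates 1 from 0 and [w]; when d = 0,
   multiplication by [u] also keeps 0 and [w] apart. *)
have nuc : (u * c \is a GRing.unit) = (c' \is a GRing.unit).
  by rewrite -e Zn_unitD_nonunit // unitrM (negPf nd).
have [d0|dn0] := eqVneq d 0.
  rewrite d0 mul0r addr0 in e.
  case/or3P: Ck => [/eqP c0|/andP[/eqP c1 _]|/andP[/eqP cw _]].
  - by rewrite -e c0 mulr0.
  - move: nuc; rewrite c1 mulr1 Uu;
      case/or3P: Cl => [/eqP->|/andP[/eqP->]//|/andP[/eqP-> _]].
      by rewrite (negPf N0).
    by rewrite (negPf Nw).
  - case/or3P: Cl => [/eqP c0|/andP[/eqP c1 _]|/andP[/eqP-> //]].
      by move/eqP: e; rewrite c0 cw mulrI_eq0 ?(negPf w_neq0) //; apply: mulrI.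
    by move: nuc; rewrite c1 cw unitrM (negPf Nw) andbF unitr1.
move: Ck Cl nuc; rewrite nd (negPf dn0) !andbF !andbT !orbF unitrM Uu /=.
by case/orP=> /eqP-> /orP[] /eqP-> //; rewrite unitr1 (negPf N0).
Qed.

Lemma card_Zrep : #|Zrep| = ((p * p.-1) ^ 2 + p * (p * p.-2) + p * p.-2)%N.
Proof.
pose U (x : Zn) := x \is a GRing.unit.
have w_neq1 : w != 1.
  by apply/eqP => w1; move: ww w_neq0; rewrite w1 mulr1 => ->; rewrite eqxx.
(* For fixed units a, b there is one constant, a second if d = 1 - a - b is a non-unit, and a third
   if moreover d = 0. *)
rewrite card_pair_sum; transitivity (\sum_(ab : Zn * Zn)
    ((U ab.1 && U ab.2) + (U ab.1 && (U ab.2 && ~~ U (1 - ab.1 - ab.2)%R)) +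
     (U ab.1 && (U ab.2 && (1 - ab.1 - ab.2 == 0)%R))))%N.
  apply: eq_bigr => -[a b] _ /=; rewrite /U.
  have [Ua|nUa] := boolP (a \is a GRing.unit); last first.
    by apply: eq_card0 => c; rewrite !inE /= (negPf nUa).
  have [Ub|nUb] := boolP (b \is a GRing.unit); last first.
    by apply: eq_card0 => c; rewrite !inE /= (negPf nUb) andbF.
  set d := 1 - a - b; under eq_finset => c do rewrite !inE /= Ua Ub -/d /=.
  have [d0|dn0] := eqVneq d 0.
    rewrite d0 unitr0 /= (@eq_card _ _ (w |: [set 0; 1])) => [|c].
      by rewrite cardsU1 cards2 !inE negb_or w_neq0 w_neq1 eq_sym oner_neq0.
    by rewrite !inE !andbT orbA orbC.
  rewrite addn0; have [Ud|nUd] := boolP (d \is a GRing.unit).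
    rewrite (@eq_card _ _ [set 0]) ?cards1 // => c.
    by rewrite !inE ?andbF ?orbF.
  rewrite (@eq_card _ _ [set 0; 1]) ?cards2 ?(eq_sym 0) ?oner_neq0 // => c.
  by rewrite !inE ?andbF ?andbT ?orbF.
rewrite !big_split /= !sum_nat_pred; congr (_ + _ + _)%N.
- rewrite (card_fibers (P := U) (Q := fun _ => U) (m := (p * p.-1)%N)).
    by rewrite card_Zn_unit.
  by move=> _ _; apply: card_Zn_unit.
- pose P a := U a && U (1 - a).
  (* As 1 - a = b + d with d a non-unit, b is a unit exactly when 1 - a is. The condition moves to
     a, and d ranges freely over the p non-units. *)
  transitivity #|[set z : Zn * Zn | P z.1 && ~~ U (1 - z.1 - z.2)]|.
    apply: eq_card => -[a b]; rewrite !inE /= /P -andbA; congr (_ && _).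
    apply: andb_id2r => nd; rewrite /U.
    by rewrite -(@Zn_unitD_nonunit b _ nd) addrC subrK.
  rewrite (card_fibers (P := P) (Q := fun a b => ~~ U (1 - a - b)) (m := p));
    first by rewrite mulnC card_Zn_unit_1B.
  move=> a _; rewrite -[RHS]card_Zn_nonunit.
  rewrite -[RHS](@card_imset _ _ (fun x : Zn => 1 - a - x)).
    apply: eq_card => x; rewrite !inE; apply/idP/imsetP => [nx|[y]].
      by exists (1 - a - x); rewrite ?inE // opprB addrC subrK.
    by rewrite inE => ny ->; rewrite opprB [X in U X]addrC subrK.
  by move=> x y /addrI/oppr_inj.
pose P a := U a && U (1 - a).
transitivity #|[set z : Zn * Zn | P z.1 && (z.2 == 1 - z.1)]|.
  apply: eq_card => -[a b]; rewrite !inE /= /P -andbA; congr (_ && _).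
  by rewrite subr_eq0 [b == _]eq_sym; apply: andb_id2r => /eqP->.
rewrite (card_fibers (P := P) (Q := fun a b => b == 1 - a) (m := 1%N));
  first by rewrite muln1 card_Zn_unit_1B.
by move=> a _; rewrite -[RHS](cards1 (1 - a)); apply: eq_card => x;
  rewrite !inE.
Qed.

Lemma mq_over_Zp_sqr :
  mq_over Zn = ((p * p.-1) ^ 2 + p * (p * p.-2) + p * p.-2)%N.
Proof.
rewrite mq_over_Zn -card_Zrep.
apply: (card_classes_reps (isomorphic_equivalence Zop) _ Zrep_inj).
  by move=> k; rewrite inE => /andP[].
exact: Zop_isomorphic_rep.
Qed.

End CyclicCount.

(** * Quasigroups over the plane *)

Section Plane.

Variable F : finFieldType.
Notation V := (F * F)%type.
Notation M := (V * V)%type.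
Implicit Types (A B P X Y : M) (u v w : V) (a b : F).

(* A matrix is stored as the pair of the images of the two basis vectors. *)
Definition ap A v : V :=
  (v.1 * A.1.1 + v.2 * A.2.1, v.1 * A.1.2 + v.2 * A.2.2).
Definition cmp A B : M := (ap A B.1, ap A B.2).
Definition det A : F := A.1.1 * A.2.2 - A.1.2 * A.2.1.
Definition tr A : F := A.1.1 + A.2.2.
Definition scal a : M := ((a, 0), (0, a)).
Definition adj A : M := ((A.2.2, - A.1.2), (- A.2.1, A.1.1)).
Definition scv a v : V := (a * v.1, a * v.2).

Lemma pair_addE (U W : zmodType) (u v : U * W) :
  u + v = (u.1 + v.1, u.2 + v.2).
Proof. by []. Qed.
Lemma pair_oppE (U W : zmodType) (u : U * W) : - u = (- u.1, - u.2).
Proof. by []. Qed.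
Lemma pair_zeroE (U W : zmodType) : 0 = (0, 0) :> U * W.
Proof. by []. Qed.
Definition pairE := (pair_addE, pair_oppE, pair_zeroE).

Lemma apD A : {morph ap A : u v / u + v}.
Proof. by move=> u v; rewrite !pairE /ap /=; congr (_, _); ring. Qed.

Lemma ap_scv A a v : ap A (scv a v) = scv a (ap A v).
Proof. by rewrite /ap /scv /=; congr (_, _); ring. Qed.

Lemma ap_cmp A B v : ap (cmp A B) v = ap A (ap B v).
Proof. by rewrite /ap /cmp /=; congr (_, _); ring. Qed.

Lemma ap_scal a v : ap (scal a) v = scv a v.
Proof. by rewrite /ap /scv /=; congr (_, _); ring. Qed.

Lemma ap_inj A B : ap A =1 ap B -> A = B.
Proof.
case: A B => [[a b] [c d]] [[a' b'] [c' d']] eqAB.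
have := eqAB (1, 0); have := eqAB (0, 1).
by rewrite /ap /= !mul1r !mul0r !add0r !addr0 => -[-> ->] [-> ->].
Qed.

Lemma cmpA A B X : cmp A (cmp B X) = cmp (cmp A B) X.
Proof. by rewrite /cmp /= -!ap_cmp. Qed.

Lemma cmpDl A B X : cmp (A + B) X = cmp A X + cmp B X.
Proof. by rewrite !pairE /cmp /ap /=; congr ((_, _), (_, _)); ring. Qed.

Lemma cmpDr A B X : cmp X (A + B) = cmp X A + cmp X B.
Proof. by rewrite !pairE /cmp /ap /=; congr ((_, _), (_, _)); ring. Qed.

Lemma cmpNl A X : cmp (- A) X = - cmp A X.
Proof. by rewrite !pairE /cmp /ap /=; congr ((_, _), (_, _)); ring. Qed.

Lemma cmpNr A X : cmp X (- A) = - cmp X A.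
Proof. by rewrite !pairE /cmp /ap /=; congr ((_, _), (_, _)); ring. Qed.

Lemma cmp_scalC a X : cmp X (scal a) = cmp (scal a) X.
Proof. by rewrite /cmp /ap /=; congr ((_, _), (_, _)); ring. Qed.

Lemma det_cmp A B : det (cmp A B) = det A * det B.
Proof. by rewrite /det /cmp /ap /=; ring. Qed.

Lemma cmp_adj A : cmp A (adj A) = scal (det A).
Proof. by rewrite /det /cmp /ap /scal /=; congr ((_, _), (_, _)); ring. Qed.

Lemma adj_cmp A : cmp (adj A) A = scal (det A).
Proof. by rewrite /det /cmp /ap /scal /=; congr ((_, _), (_, _)); ring. Qed.

Lemma scvK a v : a != 0 -> scv a^-1 (scv a v) = v.
Proof. by case: v => x y a0; rewrite /scv /= !mulKf. Qed.

Lemma scv_inj a : a != 0 -> injective (scv a).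
Proof. by move=> a0 u v /(congr1 (scv a^-1)); rewrite !scvK. Qed.

Lemma ap_injective A : det A != 0 -> injective (ap A).
Proof.
move=> dA u v /(congr1 (ap (adj A))); rewrite -!ap_cmp adj_cmp !ap_scal.
exact: scv_inj.
Qed.

(** If the determinant vanishes, [A] times its adjugate is 0, so injectivity makes the adjugate 0;
    then [A] kills the first basis vector. *)
Lemma ap_injective_det A : injective (ap A) -> det A != 0.
Proof.
move=> AI; apply/eqP => dA; have adj0 v : ap (adj A) v = 0.
  apply: AI; rewrite -ap_cmp cmp_adj dA ap_scal !pairE /scv /ap /=.
  by rewrite !mul0r addr0.
have /(congr1 fst)/eqP : (1, 0) = 0 :> V; last by rewrite /= oner_eq0.
apply: AI; move: (adj0 (1, 0)) (adj0 (0, 1)); rewrite !pairE /ap /adj /=.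
rewrite !mul1r !mul0r !addr0 !add0r => -[_ a12] [_ a11].
by rewrite a11 -[A.1.2]opprK a12 oppr0.
Qed.

Lemma cmp_cancel P X Y : det P != 0 -> cmp X P = cmp Y P -> X = Y.
Proof.
move=> dP e; apply: ap_inj => v; apply: (scv_inj dP).
by rewrite -!ap_scv -ap_scal -cmp_adj -!ap_cmp !cmpA e.
Qed.

Lemma cmp_cancel_l P X Y : det P != 0 -> cmp P X = cmp P Y -> X = Y.
Proof.
by move=> dP e; apply: ap_inj => v; apply: (ap_injective dP);
  rewrite -!ap_cmp e.
Qed.

Lemma det_conj P X Y : det P != 0 -> cmp P X = cmp Y P -> det X = det Y.
Proof.
move=> dP e; apply: (mulfI dP).
by rewrite -det_cmp e det_cmp mulrC.
Qed.

Lemma tr_cmpC A B : tr (cmp A B) = tr (cmp B A).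
Proof. by rewrite /tr /cmp /ap /=; ring. Qed.

Lemma tr_scal a X : tr (cmp (scal a) X) = a * tr X.
Proof. by rewrite /tr /cmp /ap /=; ring. Qed.

(** Inverses are avoided by multiplying through by det P, the product of P and its adjugate, and
    using cyclicity of the trace. *)
Lemma tr_conj P X Y : det P != 0 -> cmp P X = cmp Y P -> tr X = tr Y.
Proof.
move=> dP e; apply: (mulfI dP); rewrite -!tr_scal -{1}adj_cmp -cmpA e.
by rewrite tr_cmpC -cmpA cmp_adj cmp_scalC.
Qed.

Lemma basis_decomp P v : det P != 0 -> exists x, exists y, v = ap P (x, y).
Proof.
move=> dP; exists (scv (det P)^-1 (ap (adj P) v)).1.
exists (scv (det P)^-1 (ap (adj P) v)).2; rewrite -surjective_pairing ap_scv.
by rewrite -ap_cmp cmp_adj ap_scal scvK.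
Qed.

Lemma parallel v w : v != 0 -> det (v, w) = 0 -> exists a, w = scv a v.
Proof.
case: v w => x y [x' y']; rewrite /det /= => v0 /eqP;
  rewrite subr_eq0 => /eqP e.
have [x0|x0] := eqVneq x 0.
  have y0 : y != 0 by apply: contraNneq v0 => y0; rewrite x0 y0.
  exists (y' / y); rewrite /scv /= x0 mulr0 mulfVK //; congr (_, _).
  by apply: (mulfI y0); rewrite -e x0 mul0r mulr0.
exists (x' / x); rewrite /scv /= mulfVK //; congr (_, _).
by apply: (mulfI x0); rewrite e; field.
Qed.

Lemma cayley_hamilton A v :
  ap A (ap A v) = scv (tr A) (ap A v) - scv (det A) v.
Proof. by rewrite !pairE /ap /scv /tr /det /=; congr (_, _); ring. Qed.

Definition is_scal A := A == scal A.1.1.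

Lemma is_scalP A : reflect (exists a, A = scal a) (is_scal A).
Proof. by apply: (iffP eqP) => [->|[a ->]] //; exists A.1.1. Qed.

(** If both basis vectors are eigenvectors, [A] is diagonal with distinct entries, and then their
    sum is not an eigenvector. *)
Lemma not_scal_cyclic A : ~~ is_scal A -> exists v, det (v, ap A v) != 0.
Proof.
move/eqP; case: A => [[a b] [c d]] /= nA.
have [b0|b0] := eqVneq b 0; last first.
  by exists (1, 0); rewrite /det /ap /= !mul1r !mul0r !addr0 subr0.
have [c0|c0] := eqVneq c 0; last first.
  by exists (0, 1); rewrite /det /ap /= !mul1r !mul0r !add0r oppr_eq0.
exists (1, 1); rewrite /det /ap /= !mul1r b0 c0 add0r addr0 subr_eq0.
by apply/eqP => da; apply: nA; rewrite b0 c0 da.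
Qed.

(** The companion matrix of X^2 - tX + d, as images: e1 goes to e2, and e2 to - d e1 + t e2. *)
Definition companion (t d : F) : M := ((0, 1), (- d, t)).

(** The second column is Cayley-Hamilton applied to v. *)
Lemma cyclic_frame A v :
  cmp (v, ap A v) (companion (tr A) (det A)) = cmp A (v, ap A v).
Proof.
by rewrite /cmp /ap /tr /det /=; congr ((_, _), (_, _)); ring.
Qed.

End Plane.

(** * Affine operations over the plane as matrix data *)

Section PlaneOperations.

Variable F : finFieldType.
Notation V := (F * F)%type.
Notation M := (V * V)%type.
(** Holds for prime fields; it makes every additive map of the plane a matrix. A field is used
    because normal forms require division. *)
Hypothesis additive_linear :
  forall f : F -> F, {morph f : x y / x + y} -> forall x, f x = f 1 * x.

(* Translating A x + B y + c by t changes c by [ap (gam A B) t]. *)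
Definition gam (A B : M) : M := scal 1 - A - B.

Lemma ap_gam A B t : ap (gam A B) t = t - ap A t - ap B t.
Proof.
by rewrite /gam !pairE /ap /scal /=; congr (_, _); ring.
Qed.

Definition Vop (k : M * M * V) : binop V := aff (ap k.1.1) (ap k.1.2) k.2.

Definition Vparam : {set M * M * V} :=
  [set k | [&& det k.1.1 != 0, det k.1.2 != 0
             & cmp k.1.1 k.1.2 == cmp k.1.2 k.1.1]].

Lemma VparamP k :
  reflect [/\ det k.1.1 != 0, det k.1.2 != 0 & cmp k.1.1 k.1.2 = cmp k.1.2
    k.1.1]
          (k \in Vparam).
Proof.
rewrite in_set; apply: (iffP and3P) => [[dA dB /eqP AB]|[dA dB AB]]; split=> //.
exact/eqP.
Qed.

Lemma additive_ap (f : V -> V) :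
  {morph f : u v / u + v} -> f =1 ap (f (1, 0), f (0, 1)).
Proof.
move=> fM [x y].
have -> : (x, y) = (x, 0) + (0, y) :> V by rewrite pairE addr0 add0r.
rewrite fM apD; congr (_ + _).
  have f1 : {morph (fun x => (f (x, 0)).1) : x y / x + y}.
    by move=> a b; rewrite -[RHS]/((f (a, 0) + f (b, 0)).1) -fM pairE /= addr0.
  have f2 : {morph (fun x => (f (x, 0)).2) : x y / x + y}.
    by move=> a b; rewrite -[RHS]/((f (a, 0) + f (b, 0)).2) -fM pairE /= addr0.
  rewrite [LHS]surjective_pairing (additive_linear f1) (additive_linear f2) /ap
    /=.
  by rewrite !mul0r !addr0 ![_ * x]mulrC.
have f1 : {morph (fun x => (f (0, x)).1) : x y / x + y}.
  by move=> a b; rewrite -[RHS]/((f (0, a) + f (0, b)).1) -fM pairE /= addr0.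
have f2 : {morph (fun x => (f (0, x)).2) : x y / x + y}.
  by move=> a b; rewrite -[RHS]/((f (0, a) + f (0, b)).2) -fM pairE /= addr0.
rewrite [LHS]surjective_pairing (additive_linear f1) (additive_linear f2) /ap
  /=.
by rewrite !mul0r !add0r ![_ * y]mulrC.
Qed.

Lemma additive_ap_det (f : V -> V) :
  {morph f : u v / u + v} -> injective f -> det (f (1, 0), f (0, 1)) != 0.
Proof.
move=> fM fI; apply: ap_injective_det => u v.
by rewrite -!(additive_ap fM) => /fI.
Qed.

Definition affine_conj (k l : M * M * V) : Prop :=
  exists P, [/\ det P != 0, cmp P k.1.1 = cmp l.1.1 P, cmp P k.1.2 = cmp l.1.2 P
              & exists t, l.2 = ap P k.2 + ap (gam l.1.1 l.1.2) t].

Lemma Vop_isomorphicP k l :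
  k \in Vparam -> l \in Vparam -> reflect (affine_conj k l) (isomorphic (Vop k)
    (Vop l)).
Proof.
case: k l => [[A B] c] [[A' B'] c']; rewrite !inE /=.
move=> /and3P[dA dB _] /and3P[dA' dB' _].
apply: (iffP (aff_isomorphicP _ _ (ap_injective dA) (ap_injective dB)
               (@apD _ A) (@apD _ B) (@apD _ A') (@apD _ B'))).
  case=> g [t [/bij_inj gI gM gA gB gc]].
  have gE := additive_ap gM; exists (g (1, 0), g (0, 1)); split=> /=.
  - exact: additive_ap_det.
  - by apply: ap_inj => v; rewrite !ap_cmp -!gE.
  - by apply: ap_inj => v; rewrite !ap_cmp -!gE.
  exists t; rewrite -gE ap_gam; apply: (addrI (ap A' t + ap B' t)).
  by rewrite -gc -[t - _ - _]addrA -opprD [RHS]addrCA [_ + (t - _)]addrC subrK.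
case=> P [/= dP PA PB [t ->]]; exists (ap P), t; split.
- by apply: injF_bij; apply: ap_injective.
- exact: apD.
- by move=> v; rewrite -!ap_cmp PA.
- by move=> v; rewrite -!ap_cmp PB.
rewrite /= ap_gam -[t - _ - _]addrA -opprD [RHS]addrCA.
by rewrite [_ + (t - _)]addrC subrK.
Qed.

Lemma mq_over_plane :
  mq_over (F * F)%type =
    #|equivalence_partition (fun k l => isomorphic (Vop k) (Vop l)) Vparam|.
Proof.
apply: mq_over_param => [k|op /and3P[_ m /affine_formP]].
  rewrite inE => /and3P[dA dB /eqP AB].
  have [AI BI] := (ap_injective dA, ap_injective dB); apply/and3P; split.
  - exact: aff_quasigroup.
  - by apply/(aff_medial _ (@apD _ _) (@apD _ _)) => x; rewrite -!ap_cmp AB.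
  - apply/affine_formP; exists (ap k.1.1), (ap k.1.2), k.2.
    by split=> //; [apply: apD|apply: apD|apply: isomorphic_refl].
case=> phi [psi [c [phiI psiI phiM psiM iso]]].
have [phiE psiE] := (additive_ap phiM, additive_ap psiM).
have {}iso : isomorphic op (Vop ((phi (1, 0), phi (0, 1)), (psi (1, 0),
  psi (0, 1)), c)).
  congr (isomorphic op _): iso; apply/ffunP => xy.
  by rewrite !ffunE /= -phiE -psiE.
exists ((phi (1, 0), phi (0, 1)), (psi (1, 0), psi (0, 1)), c) => //.
rewrite inE /= !additive_ap_det //=; apply/eqP/ap_inj => v; rewrite !ap_cmp.
have := medial_isomorphic (isomorphic_sym iso) m.
by move/(aff_medial _ (@apD _ _) (@apD _ _)).
Qed.

End PlaneOperations.

(** * Invariants of affine conjugacy *)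

Section PlaneClasses.

Variable F : finFieldType.
Notation V := (F * F)%type.
Notation M := (V * V)%type.
Hypothesis additive_linear :
  forall f : F -> F, {morph f : x y / x + y} -> forall x, f x = f 1 * x.
Implicit Types (k l : M * M * V) (A B P : M) (a b : F) (c t v w : V) (S : {set
  M * M * V}).

Let R (k l : M * M * V) := isomorphic (Vop k) (Vop l).
Notation q := #|F|.

Lemma card_conj_classes_split S (Q : pred (M * M * V)) :
    S \subset Vparam F ->
    {in S &, forall k l, affine_conj k l -> Q k -> Q l} ->
  #|equivalence_partition R S| =
    (#|equivalence_partition R [set k in S | Q k]| +
     #|equivalence_partition R [set k in S | ~~ Q k]|)%N.
Proof.
move=> /subsetP sS simQ; apply: card_classes_split.
  exact: isomorphic_equivalence.
move=> k l Sk Sl; have [Sk' Sl'] := (sS _ Sk, sS _ Sl).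
by move=> /(Vop_isomorphicP additive_linear Sk' Sl'); apply: simQ.
Qed.

Lemma card_conj_classes_reps S (K : finType) (N : {set K}) (rep : K -> M * M *
  V) :
    S \subset Vparam F ->
    {in N, forall i, rep i \in S} ->
    {in N &, forall i j, affine_conj (rep i) (rep j) -> i = j} ->
    {in S, forall x, exists2 i, i \in N & affine_conj (rep i) x} ->
  #|equivalence_partition R S| = #|N|.
Proof.
move=> /subsetP sS repS repI repR.
apply: (card_classes_reps (isomorphic_equivalence _) repS) => [k l Nk Nl|x Sx].
  by move/(Vop_isomorphicP additive_linear (sS _ (repS k Nk)) (sS _ (repS l
    Nl)))/repI; apply.
have [k Nk sim] := repR x Sx; exists k => //.
exact/(Vop_isomorphicP additive_linear (sS _ (repS k Nk)) (sS _ Sx)).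
Qed.

(* Some element is idempotent exactly when a translation moves the constant to
   0. *)
Definition has_idempotent (k : M * M * V) :=
  [exists t, k.2 == ap (gam k.1.1 k.1.2) t].
Lemma gam_conj A B A' B' P :
  cmp P A = cmp A' P -> cmp P B = cmp B' P ->
  cmp P (gam A B) = cmp (gam A' B') P.
Proof.
move=> PA PB; rewrite /gam !cmpDr !cmpDl !cmpNr !cmpNl PA PB.
by rewrite cmp_scalC.
Qed.

Lemma has_idempotent_conj k l : affine_conj k l -> has_idempotent k ->
  has_idempotent l.
Proof.
case: k l => [[A B] c] [[A' B'] c'] [P [/= dP PA PB [t ->]]].
case/existsP=> /= s /eqP ->; apply/existsP; exists (ap P s + t);
  apply/eqP => /=.
by rewrite -ap_cmp (gam_conj PA PB) ap_cmp apD.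
Qed.

Lemma is_scal_conj A A' P :
  det P != 0 -> cmp P A = cmp A' P -> is_scal A -> A' = A.
Proof.
move=> dP PA /is_scalP[a Aa]; apply: (cmp_cancel dP).
by rewrite -PA Aa cmp_scalC.
Qed.

Lemma is_scal_affine_conj k l : affine_conj k l ->
  (is_scal k.1.1 -> is_scal l.1.1) * (is_scal k.1.2 -> is_scal l.1.2).
Proof.
case=> P [dP PA PB _]; split=> h.
  by rewrite (is_scal_conj dP PA h).
by rewrite (is_scal_conj dP PB h).
Qed.

Lemma gam0_affine_conj k l : affine_conj k l ->
  gam k.1.1 k.1.2 == 0 -> gam l.1.1 l.1.2 == 0.
Proof.
case=> P [dP PA PB _] /eqP g0; apply/eqP/(cmp_cancel dP).
rewrite -(gam_conj PA PB) g0.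
by rewrite !pairE /cmp /ap /= !mulr0 !mul0r !addr0.
Qed.

Lemma tr_gam_affine_conj k l : affine_conj k l ->
  tr (gam k.1.1 k.1.2) = tr (gam l.1.1 l.1.2).
Proof. by case=> P [dP PA PB _]; apply: (tr_conj dP (gam_conj PA PB)). Qed.

Lemma ap0m t : ap 0 t = 0.
Proof. by rewrite !pairE /ap /= !mulr0 addr0. Qed.

Lemma apm0 A : ap A 0 = 0.
Proof. by rewrite !pairE /ap /= !mul0r addr0. Qed.

Lemma det_pair_ap P v w : @det F (ap P v, ap P w) = det P * @det F (v, w).
Proof. by rewrite -det_cmp. Qed.

Definition cyclic_const (k : M * M * V) := @det F (k.2, ap k.1.1 k.2) != 0.

(** When gam is 0 translations leave the constant alone, so [P] carries the vectors c, A c of one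
    triple to those of the other. *)
Lemma cyclic_const_affine_conj k l : affine_conj k l -> gam l.1.1 l.1.2 = 0 ->
  cyclic_const k -> cyclic_const l.
Proof.
case=> P [dP PA _ [t e]] g0; rewrite /cyclic_const e g0 ap0m addr0.
by rewrite -ap_cmp -PA ap_cmp det_pair_ap => ?; rewrite mulf_neq0.
Qed.

Lemma card_neq1 a : #|[set x : F | x != a]| = q.-1.
Proof. by rewrite -(cardsC1 a); apply: eq_card => x; rewrite !inE. Qed.

Lemma card_neq2 a b : a != b -> #|[set x : F | (x != a) && (x != b)]| = q.-2.
Proof.
move=> ab; have := cardsC [set a; b]; rewrite cards2 ab => <- /=.
by apply: eq_card => x; rewrite !inE negb_or.
Qed.

Lemma det_scal a : det (scal a) = a * a.
Proof. by rewrite /det /scal /= mulr0 subr0. Qed.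

Lemma scal_inj a b : scal a = scal b :> M -> a = b.
Proof. by case. Qed.

Lemma subset_setId S S' (Q : pred (M * M * V)) :
  S \subset S' -> [set k in S | Q k] \subset S'.
Proof. by apply: subset_trans; rewrite setIdE subsetIl. Qed.

Lemma mem_setId S (Q : pred (M * M * V)) k :
  k \in S -> Q k -> k \in [set k in S | Q k].
Proof. by move=> Sk Qk; rewrite in_set Sk. Qed.

(** * Quasigroups over the plane with an idempotent *)

Definition Videm := [set k in Vparam F | has_idempotent k].
Definition Videm_scal := [set k in Videm | is_scal k.1.1].

(** Conjugation fixes scalar matrices, so the pair of scalars is itself the invariant. *)
Lemma classes_scal_scal :
  #|equivalence_partition R [set k in Videm_scal | is_scal k.1.2]| = (q.-1 *
    q.-1)%N.
Proof.
pose N := [set ab : F * F | (ab.1 != 0) && (ab.2 != 0)].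
pose rep (ab : F * F) : M * M * V := (scal ab.1, scal ab.2, 0).
rewrite (@card_conj_classes_reps _ _ N rep).
- rewrite (card_fibers (P := fun a => a != 0) (Q := fun _ x =>
    x != 0) (m := q.-1)).
    by rewrite card_neq1.
  by move=> _ _; apply: card_neq1.
- by rewrite !subset_setId.
- case=> a b; rewrite in_set /= => /andP[a0 b0]; apply: mem_setId;
    [apply: mem_setId; [apply: mem_setId|]|].
  + by apply/VparamP; rewrite /= !det_scal !mulf_neq0 // cmp_scalC.
  + by apply/existsP; exists 0; rewrite apm0.
  + by apply/is_scalP; exists a.
  + by apply/is_scalP; exists b.
- move=> [a b] [a' b'] _ _ [P [/= dP PA PB _]].
  have scv1 (x : F) : is_scal (scal x : M) by rewrite /is_scal eqxx.
  have /scal_inj -> := is_scal_conj dP PA (scv1 _).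
  by have /scal_inj -> := is_scal_conj dP PB (scv1 _).
case=> [[A B] c] /setIdP[/setIdP[/setIdP[/VparamP[/= dA dB _]]]].
move=> /existsP[/= t /eqP ct] /is_scalP[/= a Aa] /is_scalP[/= b Bb].
exists (a, b).
  rewrite in_set /=; move: dA dB; rewrite Aa Bb !det_scal !mulf_eq0 !orbb.
  by move=> -> ->.
exists (scal 1); split=> /=.
- by rewrite det_scal mulr1 oner_eq0.
- by rewrite Aa cmp_scalC.
- by rewrite Bb cmp_scalC.
- by exists t; rewrite apm0 add0r.
Qed.

Lemma tr_companion (t d : F) : tr (companion t d) = t.
Proof. by rewrite /tr /companion /= add0r. Qed.

Lemma det_companion (t d : F) : det (companion t d) = d.
Proof. by rewrite /det /companion /= mul0r sub0r mul1r opprK. Qed.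

Lemma companion_conj P (t d t' d' : F) :
  det P != 0 -> cmp P (companion t d) = cmp (companion t' d') P -> t = t' /\ d
    = d'.
Proof.
move=> dP PC; have := tr_conj dP PC; have := det_conj dP PC.
by rewrite !tr_companion !det_companion.
Qed.

Lemma companion_not_scal (t d : F) : ~~ is_scal (companion t d).
Proof. by apply/is_scalP => -[a] [_ /eqP]; rewrite oner_eq0. Qed.

(** The scalar commutes with any change of basis, so only [B] has to be brought to companion form;
    its trace is free and its determinant nonzero. *)
Lemma classes_scal_comp :
  #|equivalence_partition R [set k in Videm_scal | ~~ is_scal k.1.2]| =
    (q.-1 * (q * q.-1))%N.
Proof.
pose N := [set z : F * (F * F) | (z.1 != 0) && (z.2.2 != 0)].
pose rep (z : F * (F * F)) : M * M * V := (scal z.1, companion z.2.1 z.2.2, 0).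
rewrite (@card_conj_classes_reps _ _ N rep).
- rewrite (card_fibers (P := fun a => a != 0) (Q := fun _ z => z.2 != 0)
            (m := (q * q.-1)%N)); first by rewrite card_neq1.
  move=> _ _; transitivity #|[set z : F * F | xpredT z.1 && (z.2 != 0)]|.
    by apply: eq_card => z; rewrite !inE.
  rewrite (card_fibers (P := xpredT) (Q := fun _ x => x != 0) (m := q.-1)).
    by congr (_ * _)%N; apply: eq_card => x; rewrite !inE.
  by move=> _ _; apply: card_neq1.
- by rewrite !subset_setId.
- case=> a [t d]; rewrite in_set /= => /andP[a0 d0]; apply: mem_setId;
    [apply: mem_setId; [apply: mem_setId|]|].
  + by apply/VparamP; rewrite /= det_scal mulf_neq0 // det_companion cmp_scalC.
  + by apply/existsP; exists 0; rewrite apm0.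
  + by apply/is_scalP; exists a.
  + exact: companion_not_scal.
- move=> [a [t d]] [a' [t' d']] _ _ [P [/= dP PA PB _]].
  have scv1 (x : F) : is_scal (scal x : M) by rewrite /is_scal eqxx.
  have /scal_inj -> := is_scal_conj dP PA (scv1 _).
  by have [-> ->] := companion_conj dP PB.
case=> [[A B] c] /setIdP[/setIdP[/setIdP[/VparamP[/= dA dB _]]]].
move=> /existsP[/= t /eqP ct] /is_scalP[/= a Aa] /not_scal_cyclic[/= v dv].
exists (a, (tr B, det B)).
  by rewrite in_set /= dB andbT; move: dA; rewrite Aa det_scal mulf_eq0 orbb.
exists (v, ap B v); split=> //=.
- by rewrite Aa cmp_scalC.
- exact: cyclic_frame.
- by exists t; rewrite apm0 add0r.
Qed.

Definition pol (x y : F) A : M := scal x + cmp (scal y) A.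

Lemma det_pol_comp (x y t d : F) :
  det (pol x y (companion t d)) = x * x + x * y * t + y * y * d.
Proof. by rewrite /pol pairE /det /cmp /ap /scal /companion /=; ring. Qed.

Lemma pol_comm (x y : F) A : cmp A (pol x y A) = cmp (pol x y A) A.
Proof. by rewrite /pol cmpDr cmpDl cmp_scalC cmpA cmp_scalC. Qed.

Lemma pol_conj (x y : F) A A' P :
  cmp P A = cmp A' P -> cmp P (pol x y A) = cmp (pol x y A') P.
Proof.
by move=> PA; rewrite /pol cmpDr cmpDl cmp_scalC cmpA cmp_scalC -cmpA PA cmpA.
Qed.

Lemma pol_comp_inj (x y x' y' t d : F) :
  pol x y (companion t d) = pol x' y' (companion t d) -> x = x' /\ y = y'.
Proof.
rewrite /pol !pairE /cmp /ap /scal /companion /=.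
by rewrite !(mulr0, mul0r, addr0, add0r, mul1r, mulr1) => -[-> ->].
Qed.

(** Take x, y with B v = x v + y A v. Then [B] and [pol x y A] agree at v, and at A v too since both
    commute with A. *)
Lemma commutant_pol A B v :
  @det F (v, ap A v) != 0 -> cmp A B = cmp B A -> exists x, exists y,
    B = pol x y A.
Proof.
move=> dv AB; have [x [y Bv]] := basis_decomp (ap B v) dv.
exists x, y; apply: (cmp_cancel dv).
have Cv u : ap (pol x y A) u = scv x u + scv y (ap A u).
  by rewrite /pol !pairE /cmp /ap /scv /scal /=; congr (_, _); ring.
have {}Bv : ap B v = scv x v + scv y (ap A v).
  by rewrite Bv !pairE /ap /scv /=; congr (_, _); ring.
rewrite /cmp /= !Cv Bv -ap_cmp -AB ap_cmp Bv apD !ap_scv //.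
Qed.

(** Slice by (x, y). If exactly one is 0, the second condition is automatic for d nonzero. If
    neither is, it is linear in t with coefficient xy and excludes one t for each d. *)
Lemma card_pol_comp :
  #|[set z : (F * F) * (F * F) | (z.2.1 != 0) &&
     (z.1.1 * z.1.1 + z.1.1 * z.1.2 * z.2.2 + z.1.2 * z.1.2 * z.2.1 != 0)]| =
  ((q * q.-1) * (q.-1 + q.-1) + (q.-1 * q.-1) * (q.-1 * q.-1))%N.
Proof.
have card_d : #|[set z : F * F | z.1 != 0]| = (q * q.-1)%N.
  transitivity #|[set z : F * F | (z.1 != 0) && xpredT z.2]|.
    by apply: eq_card => z; rewrite !inE andbT.
  rewrite mulnC (card_fibers (P := fun x => x != 0) (Q := fun _ =>
    xpredT) (m := q)).
    by rewrite card_neq1.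
  by move=> x _; apply: eq_card => y; rewrite !inE.
rewrite card_pair_sum; transitivity (\sum_(z : F * F)
   (q * q.-1 * ((z.1 != 0%R) && (z.2 == 0%R) + (z.1 == 0%R) && (z.2 != 0%R)) +
    q.-1 * q.-1 * ((z.1 != 0%R) && (z.2 != 0%R))))%N.
  apply: eq_bigr => -[x y] _ /=.
  have [->|x0] := eqVneq x 0.
    have [->|y0] /= := eqVneq y 0.
      rewrite !muln0; apply: eq_card0 => z.
      by rewrite !inE /= !(mul0r, addr0) eqxx andbF.
    rewrite muln0 muln1 addn0 -card_d; apply: eq_card => z; rewrite !inE /=.
    by rewrite !mul0r !add0r !mulf_eq0 (negPf y0) andbb.
  have [->|y0] /= := eqVneq y 0.
    rewrite muln0 muln1 addn0 -card_d; apply: eq_card => z; rewrite !inE /=.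
    by rewrite !(mulr0, mul0r, addr0) mulf_neq0 // andbT.
  rewrite muln0 muln1 add0n -{1}(card_neq1 0).
  rewrite -(card_fibers (P := fun d : F => d != 0)
    (Q := fun d s : F => x * x + x * y * s + y * y * d != 0)) // => d d0.
  rewrite -[RHS](card_neq1 (- (x * x + y * y * d) / (x * y))).
  apply: eq_card => t; rewrite !inE; congr (~~ _).
  have xy0 : x * y != 0 by rewrite mulf_neq0.
  rewrite -[RHS](inj_eq (mulfI xy0)) [x * y * (_ / _)]mulrC divfK //.
  by rewrite -[RHS]subr_eq0; congr (_ == _); ring.
rewrite big_split -!big_distrr /= big_split /= !sum_nat_pred.
rewrite (card_fibers (P := fun x => x != 0) (Q := fun _ y =>
  y == 0) (m := 1%N)) => [|x _]; last first.
  by rewrite -[RHS](cards1 (0 : F)); apply: eq_card => y; rewrite !inE.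
rewrite (card_fibers (P := fun x => x == 0) (Q := fun _ y =>
  y != 0) (m := q.-1)) => [|x _]; last exact: card_neq1.
rewrite (card_fibers (P := fun x => x != 0) (Q := fun _ y =>
  y != 0) (m := q.-1)) => [|x _]; last exact: card_neq1.
rewrite card_neq1 muln1 (_ : #|[set x : F | x == 0]| = 1%N) ?mul1n //.
by rewrite -[RHS](cards1 (0 : F)); apply: eq_card => y; rewrite !inE.
Qed.

(** A cyclic vector brings [A] to companion form, and [B] is then x + y A; the numbers x, y, det A,
    tr A classify the pair. *)
Lemma classes_comp :
  #|equivalence_partition R [set k in Videm | ~~ is_scal k.1.1]| =
  ((q * q.-1) * (q.-1 + q.-1) + (q.-1 * q.-1) * (q.-1 * q.-1))%N.
Proof.
pose rep (z : (F * F) * (F * F)) : M * M * V :=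
  (companion z.2.2 z.2.1, pol z.1.1 z.1.2 (companion z.2.2 z.2.1), 0).
rewrite -card_pol_comp; apply: (@card_conj_classes_reps _ _ _ rep).
- by rewrite !subset_setId.
- case=> [[x y] [d t]]; rewrite in_set /= => /andP[d0 p0]; apply: mem_setId;
    [apply: mem_setId|].
  + by apply/VparamP; rewrite /= det_companion det_pol_comp pol_comm.
  + by apply/existsP; exists 0; rewrite apm0.
  + exact: companion_not_scal.
- move=> [[x y] [d t]] [[x' y'] [d' t']] _ _ [P [/= dP PA PB _]].
  (* The two companion matrices coincide, so [P] commutes with it and with its polynomials; hence x
     and y cannot change. *)
  have [tE dE] := companion_conj dP PA; rewrite -tE -dE in PA PB *.
  by rewrite (pol_conj _ _ PA) in PB;
    have [-> ->] := pol_comp_inj (cmp_cancel dP PB).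
case=> [[A B] c] /setIdP[/setIdP[/VparamP[/= dA dB AB]]].
move=> /existsP[/= t /eqP ct] /not_scal_cyclic[/= v dv].
have [x [y BE]] := commutant_pol dv AB.
have vA := cyclic_frame A v.
exists ((x, y), (det A, tr A)).
  by rewrite in_set /= dA -det_pol_comp (det_conj dv (pol_conj x y vA)) -BE.
exists (v, ap A v); split=> //=.
- by rewrite (pol_conj _ _ vA) BE.
- by exists t; rewrite apm0 add0r.
Qed.

(** * Quasigroups over the plane without an idempotent *)

Definition Vnidem := [set k in Vparam F | ~~ has_idempotent k].
Definition Vnidem_gam0 := [set k in Vnidem | gam k.1.1 k.1.2 == 0].
Definition Vnidem_gamN0 := [set k in Vnidem | gam k.1.1 k.1.2 != 0].

Lemma gam_subr A : gam A (scal 1 - A) = 0.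
Proof. by rewrite /gam opprB addrA subrK subrr. Qed.

Lemma gam_eq0 A B : gam A B = 0 -> B = scal 1 - A.
Proof. by rewrite /gam => /eqP; rewrite subr_eq0 => /eqP. Qed.

Lemma one_sub_comm A : cmp A (scal 1 - A) = cmp (scal 1 - A) A.
Proof. by rewrite cmpDr cmpDl cmpNr cmpNl cmp_scalC. Qed.

Lemma one_sub_conj A A' P : cmp P A = cmp A' P ->
  cmp P (scal 1 - A) = cmp (scal 1 - A') P.
Proof. by move=> PA; rewrite cmpDr cmpDl cmpNr cmpNl cmp_scalC PA. Qed.

Lemma det_one_sub A : det (scal 1 - A) = 1 - tr A + det A.
Proof. by rewrite !pairE /det /tr /scal /=; ring. Qed.

Lemma has_idempotent_gam0 A B c :
  gam A B = 0 -> has_idempotent (A, B, c) = (c == 0).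
Proof.
move=> g0; apply/existsP/eqP => /= [[t /eqP->]|->]; first by rewrite g0 ap0m.
by exists 0; rewrite apm0.
Qed.

Lemma ap_e1 A : ap A (1, 0) = A.1.
Proof. by rewrite /ap !mul1r !mul0r !addr0 -surjective_pairing. Qed.

Lemma ap_e2 A : ap A (0, 1) = A.2.
Proof. by rewrite /ap !mul1r !mul0r !add0r -surjective_pairing. Qed.

Lemma e1_neq0 : (1, 0) != 0 :> V.
Proof. by apply/eqP => -[/eqP]; rewrite oner_eq0. Qed.

(** The frame is forced to be c, A c. The bound [z.2 != 1 + z.1] says that det (1 - A) = 1 - tr A +
    det A is nonzero, where B = 1 - A. *)
Lemma classes_cyclic :
  #|equivalence_partition R [set k in Vnidem_gam0 | cyclic_const k]| = (q.-1 *
    q.-1)%N.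
Proof.
pose N := [set z : F * F | (z.1 != 0) && (z.2 != 1 + z.1)].
pose rep (z : F * F) : M * M * V :=
  (companion z.2 z.1, scal 1 - companion z.2 z.1, (1, 0)).
rewrite (@card_conj_classes_reps _ _ N rep).
- rewrite (card_fibers (P := fun d : F => d != 0) (Q := fun d s : F =>
    s != 1 + d) (m := q.-1)).
    by rewrite card_neq1.
  by move=> d _; apply: card_neq1.
- by rewrite !subset_setId.
- case=> d t; rewrite in_set /= => /andP[d0 td].
  apply: mem_setId; [apply: mem_setId; [apply: mem_setId|]|].
  + apply/VparamP; rewrite /= det_companion det_one_sub tr_companion
      det_companion one_sub_comm.
    by split=> //; rewrite addrAC subr_eq0 eq_sym.
  + by rewrite has_idempotent_gam0 ?gam_subr ?e1_neq0.
  + by rewrite gam_subr.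
  + by rewrite /cyclic_const /= ap_e1 /det /= mulr0 subr0 mulr1 oner_neq0.
- move=> [d t] [d' t'] _ _ [P [/= dP PA _ _]].
  by have [-> ->] := companion_conj dP PA.
case=> [[A B] c] /setIdP[/setIdP[/setIdP[/VparamP[/= dA dB _] _] /eqP/= g0]].
rewrite /cyclic_const /= => cyc; have BE := gam_eq0 g0.
exists (det A, tr A).
  by rewrite in_set /= dA; move: dB;
    rewrite BE det_one_sub addrAC subr_eq0 eq_sym.
exists (c, ap A c); split=> //=; first exact: cyclic_frame.
  by rewrite BE; apply: one_sub_conj; apply: cyclic_frame.
by exists 0; rewrite apm0 addr0 ap_e1.
Qed.

Definition upper (a b d : F) : M := ((a, 0), (b, d)).

Lemma det_upper (a b d : F) : det (upper a b d) = a * d.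
Proof. by rewrite /det /= mul0r subr0. Qed.

Lemma tr_upper (a b d : F) : tr (upper a b d) = a + d.
Proof. by []. Qed.

Lemma one_sub_upper (a b d : F) :
  scal 1 - upper a b d = upper (1 - a) (- b) (1 - d).
Proof. by rewrite !pairE /= subrr sub0r. Qed.

Lemma complement_vector c : c != 0 -> exists f, @det F (c, f) != 0.
Proof.
case: c => x y c0; have [x0|x0] := eqVneq x 0; last first.
  by exists (0, 1); rewrite /det /= mulr1 mulr0 subr0.
exists (1, 0); rewrite /det /= mulr0 mulr1 sub0r oppr_eq0.
by apply: contraNneq c0 => y0; rewrite x0 y0.
Qed.

(** The first frame vector stays equal to c, so only the second may change. A multiple of c removes
    the off-diagonal entry when the eigenvalues differ; when they agree a nonzero entry is rescaled
    to 1. *)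
Lemma triangular_form A c (a : F) :
    c != 0 -> ap A c = scv a c ->
  exists P T, [/\ P.1 = c, det P != 0, cmp P T = cmp A P &
    (exists d, T = upper a 0 d) \/ T = upper a 1 a].
Proof.
move=> c0 Ac; have [f df] := complement_vector c0.
have [m [d Af]] := basis_decomp (ap A f) df.
have Pconj : cmp (c, f) (upper a m d) = cmp A (c, f).
  rewrite {2}/cmp /= Ac Af; congr (_, _).
  by rewrite /ap /scv /= !mul0r !addr0.
have trans P' T' : cmp P' T' = cmp (upper a m d) P' ->
    cmp (cmp (c, f) P') T' = cmp A (cmp (c, f) P').
  by move=> e; rewrite -cmpA e !cmpA Pconj.
have P1 (x y : F) : (cmp (c, f) ((1, 0), (x, y))).1 = c.
  by rewrite /cmp /= ap_e1.
have dP (x y : F) : y != 0 -> det (cmp (c, f) ((1, 0), (x, y))) != 0.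
  by move=> y0; rewrite det_cmp mulf_neq0 // /det /= mul0r mul1r subr0.
have [dE|da] := eqVneq d a; last first.
  have da' : d - a != 0 by rewrite subr_eq0.
  exists (cmp (c, f) ((1, 0), (m / (d - a), 1))), (upper a 0 d).
  split=> //; [by apply: dP; rewrite oner_neq0| |by left; exists d].
  by apply: trans; rewrite /upper /cmp /ap /=; congr ((_, _), (_, _)); field.
have [m0|m0] := eqVneq m 0.
  exists (c, f), (upper a 0 d); split=> //; last by left; exists d.
  by rewrite -Pconj m0.
exists (cmp (c, f) ((1, 0), (0, m^-1))), (upper a 1 a).
split=> //; [by apply: dP; rewrite invr_eq0| |by right].
by apply: trans; rewrite /upper /cmp /ap /= dE; congr ((_, _), (_, _)); field.
Qed.

(* [None] stands for the Jordan block of eigenvalue [z.1]. *)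
Definition eigen_rep (z : F * option F) : M * M * V :=
  let T := if z.2 is Some d then upper z.1 0 d else upper z.1 1 z.1 in
  (T, scal 1 - T, (1, 0)).

(** Here c is an eigenvector of [A]. Eigenvalues avoid 0 and 1 because [A] and 1 - A are invertible;
    the extra 1 in [q.-2.+1] is the Jordan block. *)
Lemma classes_eigen :
  #|equivalence_partition R [set k in Vnidem_gam0 | ~~ cyclic_const k]| = (q.-2
    * q.-2.+1)%N.
Proof.
pose P01 (x : F) := (x != 0) && (x != 1).
pose Po (o : option F) := if o is Some d then P01 d else true.
have c01 : #|[set x | P01 x]| = q.-2.
  by apply: card_neq2; rewrite eq_sym oner_neq0.
rewrite (@card_conj_classes_reps _ _ [set z | P01 z.1 && Po z.2] eigen_rep).
- rewrite (card_fibers (P := P01) (Q := fun _ =>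
    Po) (m := q.-2.+1)) ?c01 // => _ _.
  rewrite (_ : [set y | Po y] = None |: [set Some x | x in [set x | P01 x]]).
    rewrite cardsU1 card_imset ?c01; last exact: Some_inj.
    by rewrite (_ : None \in _ = false) //; apply/imsetP => -[].
  apply/setP => -[x|]; rewrite !inE //=.
  by rewrite (mem_imset _ _ Some_inj) inE.
- by rewrite !subset_setId.
- case=> a o; rewrite in_set /= => /andP[/andP[a0 a1] Poo].
  have N1 (x : F) : (1 - x != 0) = (x != 1) by rewrite subr_eq0 eq_sym.
  apply: mem_setId; [apply: mem_setId; [apply: mem_setId|]|].
  + apply/VparamP; rewrite /= one_sub_comm; case: o Poo => [d /andP[d0 d1]|_];
      by rewrite one_sub_upper !det_upper !mulf_neq0 ?N1.
  + by rewrite has_idempotent_gam0 ?gam_subr ?e1_neq0.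
  + by rewrite gam_subr.
  + rewrite /cyclic_const /= ap_e1 /det; case: o {Poo} => [d|] /=;
      by rewrite mulr0 mul0r subr0 eqxx.
- move=> [a o] [a' o'] _ _ [P [/= dP PA _ [t]]].
  rewrite gam_subr ap0m addr0 ap_e1 => P1.
  (* [P] fixes the constant, so the eigenvalue on its line is invariant and is distinguished from
     the other one. *)
  have aE : a = a'.
    move/(congr1 (fun X : M => X.1)): PA; rewrite /cmp /= -P1 ap_e1.
    by case: o o' => [d|] [d'|] /=;
      rewrite /ap /= mul0r addr0 -P1 /= mulr1 => -[].
  rewrite -aE in PA *; congr (_, _).
  case: o o' PA => [d|] [d'|] //= PA; have := tr_conj dP PA;
    rewrite !tr_upper => /addrI dE.
  + by rewrite dE.
  (* Equal traces give [d = a], so a scalar matrix would be conjugate to a Jordan block. *)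
  + have sA : is_scal (upper a 0 d) by apply/is_scalP; exists a; rewrite dE.
    have /(congr1 (fun X : M => X.2.1))/eqP := is_scal_conj dP PA sA.
    by rewrite /= oner_eq0.
  have : upper a 1 a = upper a 0 d'.
    apply: (cmp_cancel_l dP); rewrite PA -dE; exact/esym/cmp_scalC.
  by move/(congr1 (fun X : M => X.2.1))/eqP; rewrite /= oner_eq0.
case=> [[A B] c] /setIdP[/setIdP[/setIdP[/VparamP[/= dA dB _] nT] /eqP/= g0]].
rewrite /cyclic_const /= negbK => /eqP ncyc; have BE := gam_eq0 g0.
rewrite has_idempotent_gam0 // in nT.
have [a Ac] := parallel nT ncyc.
have [P [T [P1 dP PT Tcase]]] := triangular_form nT Ac.
have dT : det T != 0 by rewrite (det_conj dP PT).
have dT1 : det (scal 1 - T) != 0 by rewrite (det_conj dP (one_sub_conj PT)) -BE.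
have sim : affine_conj (T, scal 1 - T, (1, 0)) (A, B, c).
  exists P; split=> //=; first by rewrite BE; apply: one_sub_conj.
  by exists 0; rewrite apm0 addr0 ap_e1.
case: Tcase => [[d TE]|TE]; rewrite TE ?one_sub_upper !det_upper in dT dT1;
  move: dT dT1; rewrite !mulf_eq0 !negb_or !subr_eq0 ![1 == _]eq_sym
    => /andP[a0 d0] /andP[a1 d1].
  by exists (a, Some d); [rewrite in_set /= /P01 a0 a1 d0 d1 | rewrite
    /eigen_rep /= -TE].
by exists (a, None); [rewrite in_set /= /P01 a0 a1 | rewrite /eigen_rep /= -TE].
Qed.

(** * Nonzero singular gam *)

Lemma scv0l v : scv 0 v = 0.
Proof. by rewrite pair_zeroE /scv !mul0r. Qed.

Lemma scv1 v : scv 1 v = v.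
Proof. by rewrite /scv !mul1r -surjective_pairing. Qed.

Lemma scv_eq0 (a : F) v : (scv a v == 0) = (a == 0) || (v == 0).
Proof.
by case: v => x y; rewrite pair_zeroE /scv !xpair_eqE /= !mulf_eq0 orb_andr.
Qed.

Lemma ap_neq0 A : A != 0 -> exists s, ap A s != 0.
Proof.
case: A => u v; rewrite pair_zeroE xpair_eqE negb_and => /orP[u0|v0].
  by exists (1, 0); rewrite ap_e1.
by exists (0, 1); rewrite ap_e2.
Qed.

Lemma not_has_idempotent_det A B c : ~~ has_idempotent (A, B,
  c) -> det (gam A B) = 0.
Proof.
apply: contraNeq => dG; have [x [y cE]] := basis_decomp c dG.
by apply/existsP; exists (x, y); rewrite /= -cE.
Qed.

Lemma ap_sqr A v : det A = 0 -> ap A (ap A v) = scv (tr A) (ap A v).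
Proof.
by move=> dA; rewrite cayley_hamilton dA scv0l subr0.
Qed.

Lemma gam_comm A B : cmp A B = cmp B A -> cmp A (gam A B) = cmp (gam A B) A.
Proof. by move=> AB; apply: gam_conj. Qed.

(** Lets frames be adapted to [A] and gam alone: the matrix of [B] is recovered from theirs. *)
Lemma gam_gam A B : gam A (gam A B) = B.
Proof. by rewrite /gam opprB addrC subrK. Qed.

Lemma apN A v : ap A (- v) = - ap A v.
Proof. exact/morph_addN/apD. Qed.

Lemma scv0 (a : F) : scv a (0 : V) = 0.
Proof. by rewrite pair_zeroE /scv /= mulr0. Qed.

Lemma ap_pair v w (x y : F) : ap (v, w) (x, y) = scv x v + scv y w.
Proof. by []. Qed.

Lemma gam_upper (a d d' : F) :
  gam (upper a 0 d) (upper (1 - a) 0 d') = upper 0 0 (1 - d - d').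
Proof. by rewrite /gam !pairE /upper /=; congr ((_, _), (_, _)); ring. Qed.

(** Here e1 spans the kernel of gam, which is why the two eigenvalues on it add up to 1, and e2
    spans the image; the constant is e1. *)
Definition diag_rep (z : F * (F * F)) : M * M * V :=
  (upper z.1 0 z.2.1, upper (1 - z.1) 0 z.2.2, (1, 0)).

(* The pairs with d + d' = 1 are excluded since they have gam = 0; they are
   counted by [q.-2 * q.-2], moved to the left to avoid a subtraction. *)
Lemma classes_diag :
  (#|equivalence_partition R [set k in Vnidem_gamN0 | tr (gam k.1.1 k.1.2) !=
    0%R]| +
     q.-2 * q.-2 = q.-2 * (q.-1 * q.-1))%N.
Proof.
pose P01 (x : F) := (x != 0) && (x != 1).
have c01 : #|[set x | P01 x]| = q.-2.
  by apply: card_neq2; rewrite eq_sym oner_neq0.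
pose Q (z : F * F) := [&& z.1 != 0, z.2 != 0 & z.1 + z.2 != 1].
rewrite (@card_conj_classes_reps _ _ [set z | P01 z.1 && Q z.2] diag_rep).
- rewrite (card_fibers (P := P01) (Q := fun _ =>
    Q) (m := #|[set z | Q z]|)) // c01.
  rewrite -mulnDr; congr (_ * _)%N.
  have <- : #|[set z : F * F | (z.1 != 0) && (z.2 != 0)]| = (q.-1 * q.-1)%N.
    rewrite (card_fibers (P := fun x => x != 0) (Q := fun _ x =>
      x != 0) (m := q.-1)).
      by rewrite card_neq1.
    by move=> _ _; apply: card_neq1.
  rewrite -[RHS](cardsID [set z : F * F | z.1 + z.2 == 1]) addnC;
    congr (_ + _)%N.
    have -> : q.-2 = #|[set z : F * F | P01 z.1 && (z.2 == 1 - z.1)]|.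
      rewrite (card_fibers (P := P01) (Q := fun x y => y == 1 - x) (m := 1%N)).
        by rewrite c01 muln1.
      by move=> x _; rewrite -[RHS](cards1 (1 - x)); apply: eq_card => y;
        rewrite !inE.
    apply: eq_card => -[x y]; rewrite !inE /= /P01.
    rewrite [y == _]eq_sym subr_eq [y + x]addrC [1 == _]eq_sym.
    apply: andb_id2r => /eqP xy1; congr (_ && ~~ _).
    by rewrite -(inj_eq (addrI x) y 0) xy1 addr0 eq_sym.
  apply: eq_card => -[x y]; rewrite !inE /= /Q.
  by rewrite andbA andbC.
- by rewrite !subset_setId.
- case=> a [d d']; rewrite in_set /= => /and4P[/andP[a0 a1] d0 d0' dd].
  have a1' : 1 - a != 0 by rewrite subr_eq0 eq_sym.
  have l0 : 1 - d - d' != 0 by rewrite -addrA -opprD subr_eq0 eq_sym.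
  apply: mem_setId; [apply: mem_setId; [apply: mem_setId|]|].
  + apply/VparamP; rewrite /= !det_upper !mulf_neq0 //; split=> //.
    by rewrite /cmp /ap /upper /=; congr ((_, _), (_, _)); ring.
  + apply/existsP => -[t /= /eqP]; rewrite gam_upper /ap /upper /= !mulr0 addr0.
    by case=> /eqP; rewrite oner_eq0.
  + by rewrite gam_upper; apply/eqP => /(congr1 (fun X : M => X.2.2))/eqP;
      apply/negP.
  + by rewrite gam_upper tr_upper add0r.
- move=> [a [d d']] [a' [e e']] _ _ [P [/= dP PA PB [t]]].
  rewrite gam_upper ap_e1 => tE.
  (* Translations change the constant only along the second axis. *)
  have P11 : P.1.1 = 1.
    move/(congr1 fst): tE; rewrite pairE /ap /upper /= !mulr0 !addr0 => <-//.
  have aE : a = a'.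
    move/(congr1 (fun X : M => X.1.1)): PA; rewrite /cmp /ap /upper /=.
    by rewrite P11 !(mul0r, mulr0, addr0, mulr1, mul1r).
  have := tr_conj dP PA; have := tr_conj dP PB; rewrite !tr_upper -aE.
  by move=> /addrI-> /addrI->.
case=> [[A B] c] /setIdP[/setIdP[/setIdP[/VparamP[/= dA dB AB] nT] g0] /= l0].
have dG := not_has_idempotent_det nT; move: g0 l0 dG (gam_comm AB) => /=.
set G := gam A B => g0 l0 dG AG.
have GG v : ap G (ap G v) = scv (tr G) (ap G v) by apply: ap_sqr.
have AGv v : ap A (ap G v) = ap G (ap A v) by rewrite -!ap_cmp AG.
(* As G^2 = (tr G) G, the vector [u] is the component of c in the kernel of [G]; the rest, [ap G s],
   is removed by a translation. *)
pose s := scv (tr G)^-1 c; pose u := c - ap G s.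
have sK : scv (tr G) s = c by rewrite -{1}[tr G]invrK scvK ?invr_eq0.
have Gu : ap G u = 0 by rewrite /u apD apN GG -ap_scv sK subrr.
have u0 : u != 0.
  apply: contraNneq nT => /eqP; rewrite subr_eq0 => /eqP cE.
  by apply/existsP; exists s; rewrite /= -/G -cE.
(* [w] spans the image, on which [G] acts by its nonzero trace, hence is independent of the kernel
   vector [u]. *)
have [r w0] := ap_neq0 g0; pose w := ap G r.
have duw : @det F (u, w) != 0.
  apply: contraNneq w0 => /(parallel u0)[k wE].
  have : scv (tr G) w = 0 by rewrite -GG -/w wE ap_scv Gu scv0.
  by move/eqP; rewrite scv_eq0 (negPf l0).
have [a [b Au]] := basis_decomp (ap A u) duw; rewrite ap_pair in Au.
have b0 : b = 0.
  have /eqP : ap G (ap A u) = 0 by rewrite -AGv Gu apm0.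
  rewrite Au apD !ap_scv Gu scv0 add0r GG !scv_eq0 (negPf l0) (negPf w0) !orbF.
  by move/eqP.
have [x [y Ar]] := basis_decomp (ap A r) duw; rewrite ap_pair in Ar.
have [d Aw] : exists d, ap A w = scv d w.
  exists (y * tr G); rewrite /w AGv Ar apD !ap_scv Gu scv0 add0r GG /scv /=.
  by congr (_, _); ring.
have PA : cmp (u, w) (upper a 0 d) = cmp A (u, w).
  by rewrite [RHS]/cmp /= Aw Au b0 /cmp /ap /scv pairE /=;
    congr ((_, _), (_, _)); ring.
have PG : cmp (u, w) (upper 0 0 (tr G)) = cmp G (u, w).
  rewrite [RHS]/cmp /= Gu /w GG /cmp /ap /scv pairE /=;
    congr ((_, _), (_, _)); ring.
have PB := gam_conj PA PG; rewrite gam_gam in PB.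
have gE : gam (upper a 0 d) (upper 0 0 (tr G)) = upper (1 - a) 0 (1 - d - tr G).
  by rewrite /gam !pairE /upper /=; congr ((_, _), (_, _)); ring.
rewrite gE in PB.
have : det (upper a 0 d) != 0 by rewrite (det_conj duw PA).
have : det (upper (1 - a) 0 (1 - d - tr G)) != 0 by rewrite (det_conj duw PB).
rewrite !det_upper !mulf_eq0 !negb_or => /andP[a1 d0'] /andP[a0 d0].
exists (a, (d, 1 - d - tr G)).
  rewrite in_set /= /P01 /Q /= a0 d0 d0' [a == 1]eq_sym -subr_eq0 a1 /=.
  by rewrite -subr_eq0 (_ : _ - 1 = - tr G) ?oppr_eq0 //; ring.
exists (u, w); split=> //=; exists s.
by rewrite ap_e1 /= -/G subrK.
Qed.

(* Here gam is nilpotent, and the frame is (c, gam c). *)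
Definition shear_rep (z : F * F) : M * M * V :=
  (((z.1, z.2), (0, z.1)), ((1 - z.1, - z.2 - 1), (0, 1 - z.1)), (1, 0)).

Lemma gam_shear (z : F * F) :
  gam (shear_rep z).1.1 (shear_rep z).1.2 = ((0, 1), (0, 0)).
Proof. by rewrite /gam !pairE /shear_rep /=; congr ((_, _), (_, _)); ring. Qed.

(** Being singular of trace 0, gam squares to 0. [A] commutes with it, so it is a plus b gam, with a
    outside {0, 1} and b free. *)
Lemma classes_shear :
  #|equivalence_partition R [set k in Vnidem_gamN0 | ~~ (tr (gam k.1.1 k.1.2)
    != 0%R)]| =
    (q.-2 * q)%N.
Proof.
pose P01 (x : F) := (x != 0) && (x != 1).
have c01 : #|[set x | P01 x]| = q.-2.
  by apply: card_neq2; rewrite eq_sym oner_neq0.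
rewrite (@card_conj_classes_reps _ _ [set z : F * F | P01 z.1 && true]
  shear_rep).
- rewrite (card_fibers (P := P01) (Q := fun _ =>
    xpredT) (m := q)) // ?c01 // => _ _.
  by apply: eq_card => x; rewrite !inE.
- by rewrite !subset_setId.
- case=> a b; rewrite in_set /= andbT => /andP[a0 a1].
  have a1' : 1 - a != 0 by rewrite subr_eq0 eq_sym.
  apply: mem_setId; [apply: mem_setId; [apply: mem_setId|]|].
  + apply/VparamP; split; rewrite /shear_rep /=.
    * by rewrite /det /= mulr0 subr0 mulf_neq0.
    * by rewrite /det /= mulr0 subr0 mulf_neq0.
    by rewrite /cmp /ap /=; congr ((_, _), (_, _)); ring.
  + apply/existsP => -[t]; rewrite gam_shear /ap /= !mulr0 addr0 => /eqP[/eqP].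
    by rewrite oner_eq0.
  + rewrite gam_shear; apply/eqP => /(congr1 (fun X : M => X.1.2))/eqP.
    by rewrite /= oner_eq0.
  + by rewrite gam_shear /tr /= addr0 eqxx.
- move=> [a b] [a' b'] _ _ [P [dP PA PB [t]]].
  have := gam_conj PA PB; rewrite !gam_shear /= ap_e1 => PG tE.
  (* [P] commutes with the common gam and fixes the constant modulo its image. So it is a shear,
     commutes with [A], and leaves (a, b) unchanged. *)
  have P11 : P.1.1 = 1.
    by move/(congr1 fst): tE; rewrite pairE /ap /= !mulr0 !addr0.
  have P2 : P.2 = (0, 1).
    have /(congr1 (fun X : M => X.1)) := PG; rewrite /cmp /ap /= P11.
    by rewrite !(mul0r, mulr0, addr0, add0r, mul1r) -surjective_pairing.
  have /(congr1 (fun X : M => X.1)) := PA; rewrite /cmp /ap /= P11 P2 /=.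
  rewrite !(mul0r, mulr0, addr0, add0r, mul1r, mulr1) => -[-> e].
  by congr (_, _); apply: (addrI (a' * P.1.2)); rewrite e mulrC addrC.
case=> [[A B] c] /setIdP[/setIdP[/setIdP[/VparamP[/= dA dB AB] nT] g0] /= l0].
have dG := not_has_idempotent_det nT; move: g0 l0 dG (gam_comm AB) => /=.
rewrite negbK; set G := gam A B => g0 /eqP l0 dG AG.
have GG v : ap G (ap G v) = 0.
  by rewrite ap_sqr // l0 scv0l.
have basis v : ap G v != 0 -> @det F (v, ap G v) != 0.
  move=> Gv0; have v0 : v != 0 by apply: contraNneq Gv0 => ->; rewrite apm0.
  apply/eqP => /(parallel v0)[k kE]; move/eqP: (GG v).
  by rewrite kE ap_scv scv_eq0 (negPf Gv0) orbF => /eqP k0;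
     move: Gv0; rewrite kE k0 scv_eq0 eqxx.
have [s Gs0] := ap_neq0 g0; have [x [y cE]] := basis_decomp c (basis s Gs0).
(* Otherwise c would lie in the kernel of [G], which is also its image, and there would be an
   idempotent. *)
have Gc0 : ap G c != 0.
  rewrite cE ap_pair apD !ap_scv GG scv0 addr0 scv_eq0 (negPf Gs0) orbF.
  apply: contraNneq nT => x0; apply/existsP; exists (scv y s).
  by rewrite /= -/G cE ap_pair x0 ap_scv scv0l add0r.
have dP := basis c Gc0; have [a [b Ac]] := basis_decomp (ap A c) dP.
have AGc : ap A (ap G c) = scv a (ap G c).
  by rewrite -ap_cmp AG ap_cmp Ac ap_pair apD !ap_scv GG scv0 addr0.
have PA : cmp (c, ap G c) ((a, b), (0, a)) = cmp A (c, ap G c).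
  rewrite [RHS]/cmp /= AGc Ac; congr (_, _).
  by rewrite ap_pair scv0l add0r.
have PG : cmp (c, ap G c) ((0, 1), (0, 0)) = cmp G (c, ap G c).
  rewrite [RHS]/cmp /= GG; congr (_, _); rewrite ap_pair.
    by rewrite scv0l scv1 add0r.
  by rewrite !scv0l addr0.
have PB := gam_conj PA PG; rewrite gam_gam in PB.
have gE : gam ((a, b), (0, a)) ((0, 1), (0, 0)) = ((1 - a, - b - 1), (0,
  1 - a)).
  by rewrite /gam !pairE /=; congr ((_, _), (_, _)); ring.
rewrite gE in PB; exists (a, b).
  have : det ((a, b), (0, a)) != 0 by rewrite (det_conj dP PA).
  have : det ((1 - a, - b - 1), (0, 1 - a)) != 0 by rewrite (det_conj dP PB).
  rewrite /det /= !mulr0 !subr0 !mulf_eq0 !orbb subr_eq0 in_set /= /P01 andbT.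
  by rewrite eq_sym => -> ->.
by exists (c, ap G c); split=> //=; exists 0; rewrite apm0 addr0 ap_e1.
Qed.

(** A tree of invariant dichotomies with seven leaves. For a singular nonzero gam the trace
    distinguishes the diagonalizable case from the nilpotent one. *)
Lemma card_classes_plane :
  (mq_over (F * F)%type + q.-2 * q.-2)%N =
    (q.-1 * q.-1 + q.-1 * (q * q.-1) +
     ((q * q.-1) * (q.-1 + q.-1) + (q.-1 * q.-1) * (q.-1 * q.-1)) +
     (q.-1 * q.-1 + q.-2 * q.-2.+1 + (q.-2 * (q.-1 * q.-1) + q.-2 * q)))%N.
Proof.
rewrite mq_over_plane // (card_conj_classes_split (Q := has_idempotent) (subxx
  _)); last first.
  by move=> k l _ _; apply: has_idempotent_conj.
rewrite (card_conj_classes_split (S := Videm) (Q := fun k =>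
  is_scal k.1.1)) ?subset_setId //; last first.
  by move=> k l _ _ /is_scal_affine_conj[].
rewrite (card_conj_classes_split (S := Videm_scal) (Q := fun k =>
  is_scal k.1.2)) ?subset_setId //; last first.
  by move=> k l _ _ /is_scal_affine_conj[].
rewrite (card_conj_classes_split (S := Vnidem) (Q := fun k =>
  gam k.1.1 k.1.2 == 0)) ?subset_setId //; last first.
  by move=> k l _ _; apply: gam0_affine_conj.
rewrite (card_conj_classes_split (S := Vnidem_gam0) (Q := cyclic_const))
  ?subset_setId //; last first.
  by move=> k l _ /setIdP[_ /eqP g0] sim;
    apply: cyclic_const_affine_conj sim g0.
rewrite (card_conj_classes_split (S := Vnidem_gamN0) (Q := fun k =>
  tr (gam k.1.1 k.1.2) != 0)) ?subset_setId //; last first.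
  by move=> k l _ _ /tr_gam_affine_conj ->.
rewrite classes_scal_scal classes_scal_comp classes_comp classes_cyclic.
rewrite classes_eigen classes_shear -classes_diag.
by rewrite -!addnA [(q.-2 * q.-2 + q.-2 * q)%N]addnC.
Qed.

End PlaneClasses.

Lemma Fp_additive_linear (p : nat) (f : 'F_p -> 'F_p) :
  {morph f : x y / x + y} -> forall x, f x = f 1 * x.
Proof.
by move=> fM x; rewrite -{1}(natr_Zp x) morph_addMn // -mulr_natr natr_Zp.
Qed.

Lemma mq_over_Zp_pair (p : nat) : prime p ->
  (mq_over ('Z_p * 'Z_p)%type + p.-2 * p.-2)%N =
    (p.-1 * p.-1 + p.-1 * (p * p.-1) +
     ((p * p.-1) * (p.-1 + p.-1) + (p.-1 * p.-1) * (p.-1 * p.-1)) +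
     (p.-1 * p.-1 + p.-2 * p.-2.+1 + (p.-2 * (p.-1 * p.-1) + p.-2 * p)))%N.
Proof.
move=> p_pr; have := card_classes_plane (@Fp_additive_linear p).
rewrite card_Fp // => Fp_count.
(* ['F_p] is ['Z_(pdiv p)], and [pdiv p] is p for p prime. *)
have -> : mq_over ('Z_p * 'Z_p)%type = mq_over ('F_p * 'F_p)%type.
  by rewrite /= pdiv_id.
exact: Fp_count.
Qed.

Theorem corollary1p2 (p : nat) (p_prime : prime p) :
  mq (p ^ 2)%N = (mq_over 'Z_(p ^ 2) + mq_over ('Z_p * 'Z_p)%type)%N /\
  (mq (p ^ 2)%N)%:Z =
    2 * p%:Z ^+ 4 - p%:Z ^+ 3 - p%:Z ^+ 2 - 3 * p%:Z - 1.
Proof.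
split; first exact: mq_sqr_prime.
rewrite mq_sqr_prime // mq_over_Zp_sqr //.
have := mq_over_Zp_pair p_prime; move: (mq_over ('Z_p * 'Z_p)%type) => m.
(* With p = k + 2 the truncated predecessors become k + 1 and k. *)
have := prime_gt1 p_prime; case: p {p_prime} => [|[|k]] //= _ /(congr1 Posz).
rewrite !(PoszD, PoszM) => mE.
(* The correction (p - 2)^2 is k * k and can be subtracted over the integers. *)
have -> : Posz m = Posz m + Posz k * Posz k - Posz k * Posz k by rewrite addrK.
rewrite mE.
have [-> ->] : Posz k.+2 = Posz k + 2 /\ Posz k.+1 = Posz k + 1.
  by split; rewrite -PoszD ?addn1 ?addn2.
ring.
Qed.
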